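(* Let $\Sigma$ be a finite alphabet and $\Gamma=2^{\Sigma}\setminus\{\emptyset\}$. The class of 1-ATA-$\mathsf{lfr}$ over $\Gamma$ and the logic $\mathsf{RatMTL}$ over $\Sigma$ are expressively equivalent: for every 1-ATA-$\mathsf{lfr}$ $\mathcal{A}$ there is a $\mathsf{RatMTL}$ formula $\varphi$ with $L(\varphi)=L(\mathcal{A})$, and for every $\mathsf{RatMTL}$ formula $\varphi$ there is a 1-ATA-$\mathsf{lfr}$ $\mathcal{A}$ with $L(\mathcal{A})=L(\varphi)$.
   Context: Timed words: a finite timed word over $\Sigma$ is $\rho=(\sigma,\tau)$ with $\sigma=\sigma_1\cdots\sigma_n$, $\sigma_i\in\Gamma$, $\tau=\tau_1\cdots\tau_n$, $\tau_i\in\mathbb{R}_{\ge0}$, $\tau_1=0$, $\tau_i\le\tau_{i+1}$; $dom(\rho)=\{1,\dots,n\}$. An interval is an open, closed or half-open interval of $\mathbb{R}_{\ge0}$ with endpoints in $\mathbb{N}\cup\{\infty\}$. 1-clock ATA: $\mathcal{A}=(\Gamma,S,s_0,F,\delta)$ with finite location set $S$, initial location $s_0$, final locations $F\subseteq S$, and $\delta:S\times\Gamma\to\Phi(S)$ where $\Phi(S)$ is given by $\varphi::=\top\mid\bot\mid\varphi\wedge\varphi\mid\varphi\vee\varphi\mid s\mid x\in I\mid x.s$ ($s\in S$, $I$ an interval, $x$ the unique clock; $x.s$ means ''go to $s$ resetting $x$ to 0''). A configuration is a finite set of pairs $(s,\nu)\in S\times\mathbb{R}_{\ge0}$; $C+t=\{(s,\nu+t):(s,\nu)\in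 C\}$. A successor of $C$ on $a\in\Gamma$ is obtained by choosing for each $(s,\nu)\in C$ a set $M\subseteq S\cup\{x.q:q\in S\}$ making $\delta(s,a)$ true (where $x\in I$ is true iff $\nu\in I$ and an atom $p$ or $x.q$ is true iff it is in $M$) and taking the union over $(s,\nu)\in C$ of $\{(p,\nu):p\in M\}\cup\{(q,0):x.q\in M\}$. A run on $\rho$ is $C_0,\dots,C_n$ with $C_0=\{(s_0,0)\}$ and $C_i$ a successor on $\sigma_i$ of $C_{i-1}+(\tau_i-\tau_{i-1})$ ($\tau_0=0$). $\rho\in L(\mathcal{A})$ iff some run ends in a configuration all of whose locations are in $F$ (the empty configuration is accepting). Normal form: $S$ is partitioned into $S_r\cup S_{nr}$ with $s_0\in S_r$, and into islands $P_1,\dots,P_k$, each $P_i$ containing exactly one location $s_i^r\in S_r$ (its header) and $P_i\setminus\{s_i^r\}\subseteq S_{nr}$, such that for all $s\in P_i$, $a\in\Gamma$: every $q$ occurring in $\delta(s,a)$ as $x.q$ lies in $S_r$, and every location occurring in $\delta(s,a)$ not under $x.$ lies in $P_i\setminus\{s_i^r\}$. A 1-ATA-$\mathsf{lfr}$ (1-clock ATA with loop-free resets) is a 1-clock ATA in normal form with a strict partial order $\prec$ on $S_r$ such that whenever $p\in P_i$ and $x.q$ occurs in some $\delta(p,a)$, then $q=s_j^r$ with $s_j^r\prec s_i^r$. $\mathsf{RatMTL}$: formulas $\varphi::=a\ (a\in\Sigma)\mid \mathrm{true}\mid\varphi\wedge\varphi\mid\neg\varphi\mid\varphi\,\mathsf{U}_I\,\varphi\mid\mathsf{Rat}_I\,\mathsf{re}(\mathsf{S})\mid\mathsf{FRat}_{I,\mathsf{re}(\mathsf{S})}\varphi$,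 where $I$ is an interval, $\mathsf{S}$ is a finite set of formulas and $\mathsf{re}(\mathsf{S})$ is a regular expression over the alphabet $\mathsf{S}$ ($\epsilon$, letters, concatenation, $+$, ${}^*$). Semantics at position $i$ of $\rho$: $\rho,i\models a$ iff $a\in\sigma_i$; Booleans as usual; $\rho,i\models\varphi_1\mathsf{U}_I\varphi_2$ iff $\exists j>i$ with $\rho,j\models\varphi_2$, $\tau_j-\tau_i\in I$ and $\rho,k\models\varphi_1$ for all $i<k<j$. For a word $u=u_1\cdots u_m$ over $2^{\mathsf{S}}$, $[u]^{\mathsf{single}}$ is the set of words $w_1\cdots w_m$ with $w_l\in u_l$. $\mathsf{Seg}(\mathsf{S},i,j)$ ($i<j$) is the word over $2^{\mathsf{S}}$ whose letters, for $k=i+1,\dots,j-1$, are $\{\psi\in\mathsf{S}:\rho,k\models\psi\}$; $\mathsf{TSeg}(\mathsf{S},I,i)$ is the analogous word over all positions $k$ (in increasing order) with $\tau_k-\tau_i\in I$. $\rho,i\models\mathsf{FRat}_{I,\mathsf{re}}\varphi$ iff $\exists j>i$ with $\rho,j\models\varphi$, $\tau_j-\tau_i\in I$ and $[\mathsf{Seg}(\mathsf{S},i,j)]^{\mathsf{single}}\cap L(\mathsf{re})\neq\emptyset$; $\rho,i\models\mathsf{Rat}_I\mathsf{re}$ iff $[\mathsf{TSeg}(\mathsf{S},I,i)]^{\mathsf{single}}\cap L(\mathsf{re})\ne\emptyset$. $L(\varphi)=\{\rho:\rho,1\models\varphi\}$. *)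

(* Defs.v *)
From HB Require Import structures.
From mathcomp Require Import all_boot all_order all_algebra finmap.
From mathcomp Require Import boolp classical_sets reals.

Set Implicit Arguments.
Unset Strict Implicit.
Unset Printing Implicit Defensive.
Import Order.TTheory GRing.Theory Num.Theory.

Local Open Scope ring_scope.

Definition letter (Sigma : finType) : finType :=
  {X : {set Sigma} | X != finset.set0}.

(* A bound is an endpoint with a flag telling whether it belongs to the
   interval; [None] is the (always open) right endpoint $\infty$. *)
Record nat_interval := NatInterval {
  left_bound : nat * bool;
  right_bound : option (nat * bool)
}.

Definition itv_of (R : realType) (I : nat_interval) : interval R :=
  Interval
    (BSide (left_bound I).2 (left_bound I).1%:R)
    (if right_bound I is Some (u, closed) then BSide (~~ closed) u%:R
     else +oo%O).

(* Positions are numbered from 0 and a word has [tw_last.+1] of them: the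
   condition $\tau_1 = 0$ presupposes a first position. *)
Record tword (R : realType) (Gamma : finType) := TWord {
  tw_last : nat;
  sigma : 'I_tw_last.+1 -> Gamma;
  tau : 'I_tw_last.+1 -> R;
  tau_ge0 : forall i, 0 <= tau i;
  tau_first : tau ord0 = 0;
  tau_mono : forall i j : 'I_tw_last.+1, j = i.+1 :> nat -> tau i <= tau j
}.

Notation pos rho := 'I_(tw_last rho).+1.

Definition delay (R : realType) (Gamma : finType) (rho : tword R Gamma)
    (i : pos rho) : R :=
  tau i - (if i == ord0 then 0 else tau (inord i.-1 : pos rho)).

Inductive trans (S : Type) :=
  | TTop
  | TBot
  | TAnd of trans S & trans S
  | TOr of trans S & trans S
  | TLoc of S
  | TClock of nat_interval
  | TReset of S.

Fixpoint occurs_loc (S : eqType) (q : S) (f : trans S) : bool :=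
  match f with
  | TAnd f1 f2 | TOr f1 f2 => occurs_loc q f1 || occurs_loc q f2
  | TLoc s => q == s
  | _ => false
  end.

Fixpoint occurs_reset (S : eqType) (q : S) (f : trans S) : bool :=
  match f with
  | TAnd f1 f2 | TOr f1 f2 => occurs_reset q f1 || occurs_reset q f2
  | TReset s => q == s
  | _ => false
  end.

(* In [M], [inl p] stands for the atom $p$ and [inr q] for $x.q$. *)
Fixpoint trans_eval (R : realType) (S : finType) (nu : R) (M : {set S + S})
    (f : trans S) : bool :=
  match f with
  | TTop => true
  | TBot => false
  | TAnd f1 f2 => trans_eval nu M f1 && trans_eval nu M f2
  | TOr f1 f2 => trans_eval nu M f1 || trans_eval nu M f2
  | TLoc p => inl p \in M
  | TClock J => nu \in itv_of R J
  | TReset q => inr q \in M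
  end.

Record ata (Gamma : finType) := Ata {
  loc : finType;
  init : loc;
  final : {set loc};
  delta : loc -> Gamma -> trans loc
}.

Section Runs.
Variables (R : realType) (Gamma : finType) (A : ata Gamma).

Definition config := {fset (loc A * R)}.

Definition config_shift (C : config) (t : R) : config :=
  [fset (c.1, (c.2 + t)%R) | c in C]%fset.

Definition model_config (nu : R) (M : {set loc A + loc A}) : config :=
  [fset (match m with inl p => (p, nu) | inr q => (q, 0%R) end) | m in M]%fset.

Definition successor (a : Gamma) (C C' : config) : Prop :=
  exists M : loc A * R -> {set loc A + loc A},
    (forall c, c \in C -> trans_eval c.2 (M c) (delta c.1 a)) /\
    C' = (\bigcup_(c <- C) model_config c.2 (M c))%fset.

(* With 0-based positions, reading position [i] leads from the [i]-th to the
   [i.+1]-st configuration. *)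
Definition is_run (rho : tword R Gamma) (C : 'I_(tw_last rho).+2 -> config)
    : Prop :=
  C ord0 = [fset (init A, 0%R)]%fset /\
  forall i : pos rho,
    successor (sigma i)
      (config_shift (C (widen_ord (leqnSn _) i)) (delay i))
      (C (lift ord0 i)).

Definition accepting (C : config) : Prop :=
  forall c, c \in C -> c.1 \in final A.

Definition ata_lang : set (tword R Gamma) :=
  [set rho | exists C, is_run (rho := rho) C /\ accepting (C ord_max)]%classic.

End Runs.
Arguments ata_lang R [Gamma] A.

(* The island partition $P_1,\dots,P_k$ is given by the map [isl] sending each
   location to the index of its island. *)
Definition island (S : finType) (k : nat) (isl : S -> 'I_k) (i : 'I_k)
    : {set S} := [set s | isl s == i].

Definition normal_form (Gamma : finType) (A : ata Gamma) (Sr : {set loc A})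
    (k : nat) (isl : loc A -> 'I_k) (hdr : 'I_k -> loc A) : Prop :=
  [/\ init A \in Sr,
      forall i, island isl i :&: Sr = [set hdr i],
      forall i s a q, s \in island isl i ->
        occurs_reset q (delta s a) -> q \in Sr
    & forall i s a q, s \in island isl i ->
        occurs_loc q (delta s a) -> q \in island isl i :\ hdr i].

Definition loop_free_resets (Gamma : finType) (A : ata Gamma) : Prop :=
  exists (Sr : {set loc A}) (k : nat) (isl : loc A -> 'I_k)
         (hdr : 'I_k -> loc A) (prec : rel (loc A)),
  [/\ normal_form Sr isl hdr,
      {in Sr, irreflexive prec},
      {in Sr & &, transitive prec}
    & forall i p a q, p \in island isl i -> occurs_reset q (delta p a) ->
        exists2 j, q = hdr j & prec (hdr j) (hdr i)].

Inductive regex (X : Type) :=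
  | REps
  | RLetter of X
  | RCat of regex X & regex X
  | RPlus of regex X & regex X
  | RStar of regex X.
Arguments REps {X}.

Fixpoint re_lang (X : eqType) (r : regex X) : set (seq X) :=
  match r with
  | REps => [set [::]]
  | RLetter x => [set [:: x]]
  | RCat r1 r2 =>
      [set w | exists u v, [/\ w = u ++ v, re_lang r1 u & re_lang r2 v]]
  | RPlus r1 r2 => re_lang r1 `|` re_lang r2
  | RStar r1 =>
      [set w | exists2 us : seq (seq X), w = flatten us &
                 forall u, u \in us -> re_lang r1 u]
  end%classic.

(* In [MRat] and [MFRat] the finite set of formulas is listed by a family
   indexed by ['I_n], and the regular expression is over its indices. *)
Inductive ratmtl (Sigma : finType) :=
  | MLetter of Sigma
  | MTrue
  | MAnd of ratmtl Sigma & ratmtl Sigma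
  | MNot of ratmtl Sigma
  | MUntil of nat_interval & ratmtl Sigma & ratmtl Sigma
  | MRat (I : nat_interval) (n : nat) (F : 'I_n -> ratmtl Sigma)
      (re : regex 'I_n)
  | MFRat (I : nat_interval) (n : nat) (F : 'I_n -> ratmtl Sigma)
      (re : regex 'I_n) (phi : ratmtl Sigma).
Arguments MTrue {Sigma}.

Section Semantics.
Variables (R : realType) (Sigma : finType) (rho : tword R (letter Sigma)).

Definition single (X : finType) (u : seq {set X}) : set (seq X) :=
  [set w | all2 (fun x (U : {set X}) => x \in U) w u]%classic.

(* [h l k] is the truth of the [l]-th formula at position [k]. *)
Definition true_at (n : nat) (h : 'I_n -> pos rho -> Prop) (k : pos rho)
    : {set 'I_n} := [set l | `[< h l k >]].

Definition Seg (n : nat) (h : 'I_n -> pos rho -> Prop) (i j : pos rho)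
    : seq {set 'I_n} :=
  [seq true_at h k | k : pos rho <- enum (pos rho) & (i < k < j)%N].

(* No condition relates [k] and [i] besides the one on time: when 0 is in [I],
   every position with the same time stamp as [i] counts, [i] included. *)
Definition TSeg (n : nat) (h : 'I_n -> pos rho -> Prop) (I : nat_interval)
    (i : pos rho) : seq {set 'I_n} :=
  [seq true_at h k | k : pos rho <- enum (pos rho)
                   & tau k - tau i \in itv_of R I].

Fixpoint sat (phi : ratmtl Sigma) (i : pos rho) : Prop :=
  match phi with
  | MLetter a => a \in val (sigma i)
  | MTrue => True
  | MAnd p q => sat p i /\ sat q i
  | MNot p => ~ sat p i
  | MUntil J p q =>
      exists j : pos rho,
        [/\ (i < j)%N, sat q j, tau j - tau i \in itv_of R J
          & forall k : pos rho, (i < k < j)%N -> sat p k]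
  | MRat J n F re =>
      (single (TSeg (fun l => sat (F l)) J i) `&` re_lang re !=set0)%classic
  | MFRat J n F re p =>
      exists j : pos rho,
        [/\ (i < j)%N, sat p j, tau j - tau i \in itv_of R J
          & (single (Seg (fun l => sat (F l)) i j) `&` re_lang re
               !=set0)%classic]
  end.

End Semantics.

Definition ratmtl_lang (R : realType) (Sigma : finType) (phi : ratmtl Sigma)
    : set (tword R (letter Sigma)) :=
  [set rho | sat phi (ord0 : pos rho)]%classic.
Arguments ratmtl_lang R [Sigma] phi.

(* Main.v *)
Require Import Defs.
From HB Require Import structures.
From mathcomp Require Import all_boot all_order all_algebra finmap.
From mathcomp Require Import boolp classical_sets reals.
From mathcomp Require Import zify ring lra.

(* From automata to formulas: locations are treated by induction on the header
   of their island. All threads that stay in an island share one clock, so the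
   set of accepting locations of the island is computed backwards along the word
   by a function on subsets, whose value at a position depends on the letter, on
   the formulas already built for the resets, and on the region of the clock.
   Such computations are the paths of a finite graph, described by a regular
   expression over formulas, one for each region: [Rat] treats the regions
   excluding 0 and [FRat] the region {0}.

   From formulas to automata: regular expressions become nondeterministic
   islands, negation becomes dualization. [Rat_I] with 0 in [I] also looks at
   earlier positions with the same time stamp; its truth value is constant on
   blocks of equal time stamps and is determined by the future at the start of a
   block, so threads guess it there, verify the guess, and carry it along. *)

Set Implicit Arguments.
Unset Strict Implicit.
Unset Printing Implicit Defensive.
Import Order.TTheory GRing.Theory Num.Theory.

Local Open Scope ring_scope.

(** * Words and acceptance *)

(** Runs are replaced by acceptance of single threads: transition formulas are monotone and every
    state of a configuration chooses its model independently, so a configuration accepts exactly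
    when all its threads do. The acceptance of a thread satisfies a backward recursion, and this is
    why both directions compute from right to left.

    A predicate on positions counts as definable when its value at [i] is a positive Boolean
    combination, selected by the letter at [i], of freshly reset threads that start reading at
    [i.+1]. Such a combination looks at no clock, so it can serve as a guard inside any island; this
    is what allows modalities to be nested.

    The obstacle is [Rat_I] with 0 in [I]: its value may depend on positions already passed, which a
    fresh thread cannot recover. Definability is therefore relaxed to definability relative to a
    memory. The test for a new component of the memory may itself use the old memory, so the relaxed
    notion survives nesting. *)

Section Positions.
Variables (R : realType) (Gamma : finType) (rho : tword R Gamma).

Definition sg (k : nat) : Gamma := sigma (inord k : pos rho).
Definition tm (k : nat) : R := tau (inord k : pos rho).

Lemma sg_val (i : pos rho) : sg i = sigma i.
Proof. by rewrite /sg inord_val. Qed.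

Lemma tm_val (i : pos rho) : tm i = tau i.
Proof. by rewrite /tm inord_val. Qed.

Lemma tm0 : tm 0 = 0.
Proof. by rewrite -(tau_first rho) -tm_val. Qed.

Lemma tm_mono i j : (i <= j <= tw_last rho)%N -> tm i <= tm j.
Proof.
elim: j => [|j IHj] /andP[ij jn]; first by move: ij; rewrite leqn0 => /eqP->.
move: ij; rewrite leq_eqVlt => /predU1P[->//|ij].
apply: (le_trans (IHj _)); first by lia.
by apply: tau_mono; rewrite !inordK //; lia.
Qed.

Lemma backward_ind (P : nat -> Prop) :
  P (tw_last rho).+1 -> (forall k, (k <= tw_last rho)%N -> P k.+1 -> P k) ->
  forall k, (k <= (tw_last rho).+1)%N -> P k.
Proof.
move=> Pn IH k kn; rewrite -(subKn kn).
elim: (_ - k)%N => [|m IHm]; first by rewrite subn0.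
have [mn|mn] := leqP (tw_last rho).+1 m.
  by have -> : ((tw_last rho).+1 - m.+1 = (tw_last rho).+1 - m)%N by lia.
apply: IH; first by lia.
by have -> : (((tw_last rho).+1 - m.+1).+1 = (tw_last rho).+1 - m)%N by lia.
Qed.

Definition rng (k : nat) : seq nat := iota k ((tw_last rho).+1 - k).

Lemma rng_last : rng (tw_last rho).+1 = [::].
Proof. by rewrite /rng subnn. Qed.

Lemma rngS k : (k <= tw_last rho)%N -> rng k = k :: rng k.+1.
Proof. by move=> kn; rewrite /rng subSn //= subSS. Qed.

Lemma mem_rng k j : (j \in rng k) = (k <= j <= tw_last rho)%N.
Proof. rewrite mem_iota; lia. Qed.

Lemma enum_pos : enum (pos rho) = map inord (rng 0).
Proof.
rewrite /rng subn0 -val_enum_ord -map_comp.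
by rewrite -[LHS]map_id; apply: eq_map => i /=; rewrite inord_val.
Qed.

End Positions.

Section Acceptance.
Variables (R : realType) (Gamma : finType).

Fixpoint teval (S : Type) (nu : R) (L X : S -> Prop) (f : trans S) : Prop :=
  match f with
  | TTop => True
  | TBot => False
  | TAnd f1 f2 => teval nu L X f1 /\ teval nu L X f2
  | TOr f1 f2 => teval nu L X f1 \/ teval nu L X f2
  | TLoc p => L p
  | TClock J => nu \in itv_of R J
  | TReset q => X q
  end.

Lemma teval_ext (S : eqType) nu (L L' X X' : S -> Prop) f :
  (forall p, occurs_loc p f -> L p <-> L' p) ->
  (forall p, occurs_reset p f -> X p <-> X' p) ->
  teval nu L X f <-> teval nu L' X' f.
Proof.
elim: f => [||f IHf g IHg|f IHf g IHg|s|J|s] //= hL hX.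
- have [] := (IHf, IHg); case; [| |move=> ? ?; case; [| |tauto]];
    by move=> p po; (apply: hL || apply: hX); rewrite po ?orbT.
- have [] := (IHf, IHg); case; [| |move=> ? ?; case; [| |tauto]];
    by move=> p po; (apply: hL || apply: hX); rewrite po ?orbT.
- exact: hL.
- exact: hX.
Qed.

Variables (S : finType) (dl : S -> Gamma -> trans S) (fin : {set S}).
Variable rho : tword R Gamma.

(** The time [r] of the last reset is stored instead of the clock value, because it changes at
    resets only. *)
Fixpoint accn (m k : nat) (s : S) (r : R) : Prop :=
  if m is m'.+1 then
    teval (tm rho k - r) (fun p => accn m' k.+1 p r)
      (fun q => accn m' k.+1 q (tm rho k)) (dl s (sg rho k))
  else s \in fin.

(* [acc k s r]: a thread in location [s], whose clock was reset at time [r],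
   accepts the suffix of the word that starts at position [k]. *)
Definition acc (k : nat) : S -> R -> Prop := accn ((tw_last rho).+1 - k) k.

Lemma acc_last s r : acc (tw_last rho).+1 s r = (s \in fin).
Proof. by rewrite /acc subnn. Qed.

Lemma accS k s r : (k <= tw_last rho)%N ->
  acc k s r = teval (tm rho k - r) (fun p => acc k.+1 p r)
      (fun q => acc k.+1 q (tm rho k)) (dl s (sg rho k)).
Proof. by move=> kn; rewrite /acc subSn. Qed.

End Acceptance.

(** * Runs of configurations and acceptance of threads *)

Section RunAcceptance.
Variables (R : realType) (Gamma : finType) (A : ata Gamma).

Lemma trans_eval_teval nu (M : {set loc A + loc A}) (L X : loc A -> Prop) f :
  (forall p, inl p \in M -> L p) -> (forall q, inr q \in M -> X q) ->
  trans_eval (R := R) nu M f -> teval nu L X f.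
Proof.
move=> hL hX; elim: f => [||f IHf g IHg|f IHf g IHg|p|J|q] //=.
- by move=> /andP[/IHf ? /IHg].
- by case/orP=> [/IHf|/IHg]; [left | right].
- exact: hL.
- exact: hX.
Qed.

Lemma teval_trans_eval nu (L X : loc A -> Prop) f :
  teval nu L X f ->
  trans_eval (R := R) nu
    [set m | match m with inl p => `[< L p >] | inr q => `[< X q >] end] f.
Proof.
elim: f => [||f IHf g IHg|f IHf g IHg|p|J|q] //=.
- by case=> /IHf -> /IHg.
- by case=> [/IHf|/IHg] ->; rewrite ?orbT.
- by move=> h; rewrite inE; exact: asboolT.
- by move=> h; rewrite inE; exact: asboolT.
Qed.

Variable rho : tword R Gamma.
Local Notation acc := (acc (@delta _ A) (final A) rho).

(** The clock values in the [k]-th configuration are those just after position [k.-1] has been read,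
    so [prev_time k - c.2] is the last reset time of the thread [c]. *)
Definition prev_time (k : nat) : R := if k is k'.+1 then tm rho k' else 0.

(** From left to right, each state takes the largest useful model: all atoms whose threads accept.
    Conversely, any model that leads to accepting threads is contained in that one, and transition
    formulas are monotone. *)
Lemma acc_successor (k : nat) (C : config R A) : (k <= tw_last rho)%N ->
  (forall c, c \in C -> acc k c.1 (prev_time k - c.2)) <->
  exists C', successor (sg rho k) (config_shift C (tm rho k - prev_time k)) C'
    /\
    forall c, c \in C' -> acc k.+1 c.1 (prev_time k.+1 - c.2).
Proof.
move=> kn; split=> [hC|[C' [[M [hM ->]] hC']] c cC].
  pose M (c : loc A * R) : {set loc A + loc A} :=
    [set m | match m with inl p => `[< acc k.+1 p (tm rho k - c.2) >]
                       | inr q => `[< acc k.+1 q (tm rho k) >] end].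
  eexists; split; first (exists M; split; last by []).
    move=> c /imfsetP[[s nu] /= sC ->] /=.
    have := hC _ sC; rewrite accS //=; set f := delta _ _.
    have -> : nu + (tm rho k - prev_time k) = tm rho k - (prev_time k - nu).
      by ring.
    by move/teval_trans_eval; rewrite /M /= subKr.
  move=> c /bigfcupP[c0 _] /imfsetP[/= [] q]; rewrite inE => /asboolP hq -> //=.
  by rewrite subr0.
rewrite accS //.
set c1 := (c.1, c.2 + (tm rho k - prev_time k)).
have c1C : c1 \in config_shift C (tm rho k - prev_time k).
  by apply/imfsetP; exists c.
have -> : tm rho k - (prev_time k - c.2) = c1.2.
  by rewrite /c1 /=; ring.
have := hM _ c1C; apply: trans_eval_teval => q qM.
  have /= := hC' (q, c1.2); have -> : tm rho k - c1.2 = prev_time k - c.2.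
    by rewrite /c1 /=; ring.
  apply; apply/bigfcupP; exists c1; first by rewrite c1C.
  by apply/imfsetP; exists (inl q).
have /= := hC' (q, 0); rewrite subr0; apply.
apply/bigfcupP; exists c1; first by rewrite c1C.
by apply/imfsetP; exists (inr q).
Qed.

Lemma acc_run (k : nat) : (k <= (tw_last rho).+1)%N -> forall C : config R A,
  (forall c, c \in C -> acc k c.1 (prev_time k - c.2)) <->
  exists D : nat -> config R A,
    [/\ D k = C,
        forall i, (k <= i <= tw_last rho)%N ->
          successor (sg rho i) (config_shift (D i) (tm rho i - prev_time i))
            (D i.+1)
      & accepting (D (tw_last rho).+1)].
Proof.
move: k; apply: (@backward_ind _ _ rho) => [C|k kn IH C].
  split=> [hC|[D [<- _ aD]] c cC].
    exists (fun=> C); split=> // [i|c cC]; first by lia.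
    by have := hC c cC; rewrite acc_last.
  by rewrite acc_last; exact: aD.
rewrite acc_successor //; split=> [[C' [sC /IH[D [DC sD aD]]]]|[D [DC sD aD]]].
  exists (fun i => if (i <= k)%N then C else D i); rewrite leqnn; split=> //.
    move=> i /andP[ki ik]; move: ki; rewrite leq_eqVlt => /predU1P[<-|ki].
      by rewrite leqnn ltnn DC.
    by rewrite leqNgt ki leqNgt ltnS (ltnW ki) /=; apply: sD; lia.
  by rewrite leqNgt ltnS kn.
exists (D k.+1); split; first by rewrite -DC; apply: sD; lia.
by apply/IH; exists D; split=> // i ki; apply: sD; lia.
Qed.

Lemma ata_langE : ata_lang R A rho <-> acc 0 (init A) 0.
Proof.
have := @acc_run 0 isT [fset (init A, 0)]%fset.
have -> : (forall c, c \in [fset (init A, 0)]%fset ->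
    acc 0 c.1 (prev_time 0 - c.2)) <-> acc 0 (init A) 0.
  split=> [/(_ (init A, 0))|h c]; first by rewrite inE eqxx /= subr0; apply.
  by rewrite inE => /eqP->; rewrite /= subr0.
move->.
have dE (i : pos rho) : delay i = tm rho i - prev_time i.
  rewrite /delay -tm_val; congr (_ - _); case: i => -[|i] lt_i //=.
split=> [[C [[C0 sC] aC]]|[D [D0 sD aD]]].
  exists (fun i => C (inord i)); split.
  - by rewrite -C0; congr C; apply: val_inj; rewrite /= inordK.
  - move=> i /andP[_ lei]; have lti : (i < (tw_last rho).+1)%N by [].
    have := sC (Ordinal lti); rewrite -sg_val dE /=.
    by congr (successor _ (config_shift (C _) _) (C _)); apply: val_inj;
       rewrite /= inordK ?/bump //; lia.
  - by have -> : inord (tw_last rho).+1 = ord_max :> 'I_(tw_last rho).+2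
      by apply: val_inj; rewrite /= inordK.
exists (fun i => D i); split=> //; split=> // i.
rewrite -sg_val dE /= /bump /=; apply: sD.
by have := ltn_ord i; lia.
Qed.

End RunAcceptance.

(** * Predicates definable by automata with loop-free resets *)

Section Intervals.
Variable R : realType.

Definition full_itv := NatInterval (0%N, true) None.
Definition zero_itv := NatInterval (0%N, true) (Some (0%N, true)).

(** Within the nonnegative reals the complement of an interval is the union of [below] and [above],
    so a negated clock atom is a disjunction of clock atoms. A missing side is encoded as the empty
    interval from 0 to 0, open on the right. *)
Definition below (J : nat_interval) : nat_interval :=
  NatInterval (0%N, true) (Some ((left_bound J).1, ~~ (left_bound J).2)).

Definition above (J : nat_interval) : nat_interval :=
  if right_bound J is Some (u, closed) then NatInterval (u, ~~ closed) None
  else NatInterval (0%N, true) (Some (0%N, false)).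

Lemma mem_full_itv (nu : R) : 0 <= nu -> nu \in itv_of R full_itv.
Proof. by move=> nu0; rewrite in_itv /= nu0. Qed.

Lemma mem_zero_itv (nu : R) : (nu \in itv_of R zero_itv) = (nu == 0).
Proof. by rewrite in_itv /= eq_le andbC. Qed.

Lemma itv_of_ge0 J (nu : R) : nu \in itv_of R J -> 0 <= nu.
Proof.
case: J => [[l cl] r]; rewrite in_itv /= => /andP[ll _].
apply: (le_trans (ler0n _ l)); by case: cl ll => //= /ltW.
Qed.

Lemma not_mem_itv_of J (nu : R) : 0 <= nu ->
  (nu \in itv_of R (below J)) || (nu \in itv_of R (above J))
    = (nu \notin itv_of R J).
Proof.
case: J => [[l cl] [[u cu]|]] nu0; rewrite !in_itv /= ?nu0 ?andbT /=.
  rewrite negb_and; case: cl; case: cu => /=;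
  by rewrite -?leNgt -?ltNge.
by rewrite ltNge nu0 orbF; case: cl => /=; rewrite -?leNgt -?ltNge.
Qed.

End Intervals.

(** * Operations on transition formulas *)

Section TransOps.
Variables (R : realType).

Fixpoint tmap (S T : Type) (g : S -> T) (f : trans S) : trans T :=
  match f with
  | TTop => TTop _
  | TBot => TBot _
  | TAnd f1 f2 => TAnd (tmap g f1) (tmap g f2)
  | TOr f1 f2 => TOr (tmap g f1) (tmap g f2)
  | TLoc p => TLoc (g p)
  | TClock J => TClock _ J
  | TReset q => TReset (g q)
  end.

Lemma teval_map (S T : Type) (g : S -> T) (nu : R) L X f :
  teval nu L X (tmap g f) <-> teval nu (L \o g) (X \o g) f.
Proof.
by elim: f => [||f IHf h IHh|f IHf h IHh|s|J|s] //=; rewrite IHf IHh.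
Qed.

Lemma occurs_loc_map (S T : eqType) (g : S -> T) p f :
  occurs_loc p (tmap g f) -> exists2 q, p = g q & occurs_loc q f.
Proof.
elim: f => [||f IHf h IHh|f IHf h IHh|s|J|s] //=.
- by case/orP=> [/IHf|/IHh] [q -> qo]; exists q; rewrite ?qo ?orbT.
- by case/orP=> [/IHf|/IHh] [q -> qo]; exists q; rewrite ?qo ?orbT.
- by move/eqP->; exists s.
Qed.

Lemma occurs_reset_map (S T : eqType) (g : S -> T) p f :
  occurs_reset p (tmap g f) -> exists2 q, p = g q & occurs_reset q f.
Proof.
elim: f => [||f IHf h IHh|f IHf h IHh|s|J|s] //=.
- by case/orP=> [/IHf|/IHh] [q -> qo]; exists q; rewrite ?qo ?orbT.
- by case/orP=> [/IHf|/IHh] [q -> qo]; exists q; rewrite ?qo ?orbT.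
- by move/eqP->; exists s.
Qed.

Fixpoint tdual (S : Type) (f : trans S) : trans S :=
  match f with
  | TTop => TBot _
  | TBot => TTop _
  | TAnd f1 f2 => TOr (tdual f1) (tdual f2)
  | TOr f1 f2 => TAnd (tdual f1) (tdual f2)
  | TLoc p => TLoc p
  | TClock J => TOr (TClock _ (below J)) (TClock _ (above J))
  | TReset q => TReset q
  end.

Lemma teval_dual (S : Type) (nu : R) (L X L' X' : S -> Prop) f : 0 <= nu ->
  (forall p, L' p <-> ~ L p) -> (forall q, X' q <-> ~ X q) ->
  teval nu L' X' (tdual f) <-> ~ teval nu L X f.
Proof.
move=> nu0 hL hX; elim: f => [||f IHf h IHh|f IHf h IHh|s|J|s] //=.
- by split=> // _ [].
- by rewrite IHf IHh not_andP.
- by rewrite IHf IHh not_orP.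
- split=> [/orP|/negP]; first by rewrite not_mem_itv_of // => /negP.
  by rewrite -not_mem_itv_of // => /orP.
Qed.

Lemma occurs_loc_dual (S : eqType) (p : S) f :
  occurs_loc p (tdual f) = occurs_loc p f.
Proof.
by elim: f => [||f IHf h IHh|f IHf h IHh|s|J|s] //=; rewrite IHf IHh.
Qed.

Lemma occurs_reset_dual (S : eqType) (p : S) f :
  occurs_reset p (tdual f) = occurs_reset p f.
Proof.
by elim: f => [||f IHf h IHh|f IHf h IHh|s|J|s] //=; rewrite IHf IHh.
Qed.

Definition tbigor (S : Type) (I : finType) (f : I -> trans S) : trans S :=
  foldr (fun i g => TOr (f i) g) (TBot _) (enum I).

Lemma teval_bigor (S : Type) (I : finType) (f : I -> trans S) (nu : R) L X :
  teval nu L X (tbigor f) <-> exists i, teval nu L X (f i).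
Proof.
transitivity (exists2 i, i \in enum I & teval nu L X (f i)); last first.
  by split=> [[i _ ?]|[i ?]]; exists i; rewrite ?mem_enum.
rewrite /tbigor; elim: (enum I) => /= [|i s ->]; first by split=> // -[].
split=> [[fi|[j js fj]]|[j]]; first by exists i; rewrite ?inE ?eqxx.
  by exists j; rewrite // inE js orbT.
by rewrite inE => /predU1P[->|js] fj; [left | right; exists j].
Qed.

Lemma occurs_loc_bigor (S : eqType) (I : finType) (f : I -> trans S) p :
  occurs_loc p (tbigor f) -> exists i, occurs_loc p (f i).
Proof.
rewrite /tbigor; elim: (enum I) => //= i s IHs /orP[|/IHs//].
by exists i.
Qed.

Lemma occurs_reset_bigor (S : eqType) (I : finType) (f : I -> trans S) p :
  occurs_reset p (tbigor f) -> exists i, occurs_reset p (f i).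
Proof.
rewrite /tbigor; elim: (enum I) => //= i s IHs /orP[|/IHs//].
by exists i.
Qed.

(* Formulas whose value does not depend on the clock of the thread evaluating
   them: they only spawn threads in locations satisfying [hd q = q]. *)
Fixpoint pure (S : eqType) (hd : S -> S) (f : trans S) : bool :=
  match f with
  | TTop | TBot => true
  | TAnd f1 f2 | TOr f1 f2 => pure hd f1 && pure hd f2
  | TReset q => hd q == q
  | TLoc _ | TClock _ => false
  end.

Lemma pure_loc (S : eqType) (hd : S -> S) f p :
  pure hd f -> ~~ occurs_loc p f.
Proof.
elim: f => [||f IHf g IHg|f IHf g IHg|s|J|s] //=;
  by case/andP=> /IHf/negPf-> /IHg/negPf->.
Qed.

Lemma pure_reset (S : eqType) (hd : S -> S) f p :
  pure hd f -> occurs_reset p f -> hd p = p.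
Proof.
elim: f => [||f IHf h IHh|f IHf h IHh|s|J|s] //=.
- by move=> /andP[/IHf{}IHf /IHh{}IHh] /orP[].
- by move=> /andP[/IHf{}IHf /IHh{}IHh] /orP[].
- by move=> /eqP hs /eqP->.
Qed.

Lemma pure_dual (S : eqType) (hd : S -> S) f : pure hd f -> pure hd (tdual f).
Proof.
elim: f => [||f IHf g IHg|f IHf g IHg|s|J|s] //=;
  by case/andP=> /IHf-> /IHg->.
Qed.

Lemma pure_map (S T : eqType) (g : S -> T) hd hd' f :
  (forall s, hd s = s -> hd' (g s) = g s) -> pure hd f -> pure hd' (tmap g f).
Proof.
move=> hg; elim: f => [||f IHf h IHh|f IHf h IHh|q|J|q] //=.
- by case/andP=> /IHf-> /IHh->.
- by case/andP=> /IHf-> /IHh->.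
- by move/eqP/hg->.
Qed.

Lemma pure_bigor (S : eqType) (I : finType) (hd : S -> S) (f : I -> trans S) :
  (forall i, pure hd (f i)) -> pure hd (tbigor f).
Proof. by move=> hf; rewrite /tbigor; elim: (enum I) => //= i s ->;
  rewrite hf. Qed.

Lemma teval_pure (S : eqType) (hd : S -> S) f (nu nu' : R) L L' X :
  pure hd f -> teval nu L X f <-> teval nu' L' X f.
Proof.
elim: f => [||f IHf g IHg|f IHf g IHg|s|J|s] //=;
  by case/andP=> /IHf-> /IHg->.
Qed.

End TransOps.

(* Islands are the fibres of [shd], which maps a location to the header of its
   island. *)
Record sa (Gamma : finType) := Sa {
  sloc : finType;
  shd : sloc -> sloc;
  srk : sloc -> nat;
  sdl : sloc -> Gamma -> trans sloc;
  sfin : {set sloc};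
  shdK : forall s, shd (shd s) = shd s;
  sdl_reset : forall s a q, occurs_reset q (sdl s a) ->
    shd q = q /\ (srk q < srk (shd s))%N;
  sdl_loc : forall s a q, occurs_loc q (sdl s a) ->
    shd q = shd s /\ q <> shd s
}.

Section Definable.
Variables (R : realType) (Gamma : finType).
Implicit Types (P : tword R Gamma -> nat -> Prop).

Definition sacc (A : sa Gamma) := @acc R Gamma (sloc A) (@sdl _ A) (sfin A).

(** The clock value 0 and the valuation [False] are defaults: in [dfam] the formula [e] is pure, and
    its value is determined by the threads it spawns. *)
Definition entry_sat (A : sa Gamma) (e : Gamma -> trans (sloc A))
    (rho : tword R Gamma) (i : nat) : Prop :=
  teval (0 : R) (fun=> False) (fun q => sacc rho i.+1 q (tm rho i))
    (e (sg rho i)).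

(** The whole family shares one automaton, because all guards of an island have to live beside it in
    a single automaton. [def_join] reaches this form by a disjoint union. *)
Record dfam (I : Type) (P : I -> tword R Gamma -> nat -> Prop) := Dfam {
  fsa : sa Gamma;
  fent : I -> Gamma -> trans (sloc fsa);
  fpure : forall l a, pure (@shd _ fsa) (fent l a);
  fspec : forall l rho i, (i <= tw_last rho)%N ->
    P l rho i <-> entry_sat (fent l) rho i
}.

Definition def P := dfam (fun _ : unit => P).

Lemma dfam_sub (I J : Type) (P : I -> tword R Gamma -> nat -> Prop) (h : J -> I)
    (P' : J -> tword R Gamma -> nat -> Prop) :
  (forall j rho i, (i <= tw_last rho)%N -> P (h j) rho i <-> P' j rho i) ->
  dfam P -> dfam P'.
Proof.
move=> hP [A e pe se]; exists A (fun j => e (h j)) => // j rho i lei.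
by rewrite -hP //; exact: se.
Qed.

Lemma def_ext P P' :
  (forall rho i, (i <= tw_last rho)%N -> P rho i <-> P' rho i) ->
  def P -> def P'.
Proof. by move=> hP; apply: (@dfam_sub _ _ _ id) => _. Qed.

Section Dual.
Variable A : sa Gamma.

Lemma dual_reset s a q : occurs_reset q (tdual (@sdl _ A s a)) ->
  shd q = q /\ (srk q < srk (shd s))%N.
Proof. by rewrite occurs_reset_dual => /sdl_reset. Qed.

Lemma dual_loc s a q : occurs_loc q (tdual (@sdl _ A s a)) ->
  shd q = shd s /\ q <> shd s.
Proof. by rewrite occurs_loc_dual => /sdl_loc. Qed.

Definition dual_sa := Sa (~: sfin A) (@shdK _ A) dual_reset dual_loc.

(** The bound on [r] keeps the clock nonnegative, where [below] and [above] together form the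
    complement of an interval. *)
Lemma sacc_dual rho k : (k <= (tw_last rho).+1)%N -> forall s r,
  (forall j, (k <= j <= tw_last rho)%N -> r <= tm rho j) ->
  sacc (A := dual_sa) rho k s r <-> ~ sacc (A := A) rho k s r.
Proof.
move: k; apply: backward_ind => [s r _|k kn IH s r hr].
  by rewrite /sacc !acc_last inE; split=> /negP.
rewrite /sacc !accS //; apply: teval_dual.
- by rewrite subr_ge0 hr // leqnn.
- by move=> p; apply: IH => j jk; apply: hr; lia.
- by move=> q; apply: IH => j jk; apply: tm_mono; lia.
Qed.

End Dual.

Lemma def_not P : def P -> def (fun rho i => ~ P rho i).
Proof.
case=> A e pe se; exists (dual_sa A) (fun l a => tdual (e l a)).
  by move=> l a; apply: pure_dual; exact: pe.
move=> l rho i lei; rewrite (se l) // /entry_sat.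
set L := (fun=> False).
(* [teval_dual] asks for complementary valuations of the location atoms, whereas [entry_sat] has
   [False] on both sides; purity permits the exchange. *)
rewrite (@teval_pure R _ _ (tdual _) _ 0 _ (fun p => ~ L p) _ (pure_dual (pe l
  _))).
apply: iff_sym; apply: teval_dual => //.
by move=> q; apply: sacc_dual => // j jk; apply: tm_mono; lia.
Qed.

Section Join.
Variables (I : finType) (A : I -> sa Gamma).

Let S : finType := {l : I & sloc (A l)}.
Let inS l : sloc (A l) -> S := Tagged (fun l => sloc (A l)).
Let hd (s : S) : S := inS (shd (tagged s)).
Let rk (s : S) : nat := srk (tagged s).
Let dl (s : S) (a : Gamma) : trans S := tmap (@inS (tag s)) (sdl (tagged s) a).

Lemma join_hdK s : hd (hd s) = hd s.
Proof. by rewrite /hd /= shdK. Qed.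

Lemma join_reset s a q : occurs_reset q (dl s a) ->
  hd q = q /\ (rk q < rk (hd s))%N.
Proof.
by case/occurs_reset_map=> p -> /sdl_reset[hp pr]; rewrite /hd /rk /= hp.
Qed.

Lemma join_loc s a q : occurs_loc q (dl s a) -> hd q = hd s /\ q <> hd s.
Proof.
case/occurs_loc_map=> p -> /sdl_loc[hp pr]; rewrite /hd /= hp; split=> //.
by move/eqP; rewrite eq_Tagged /= => /eqP.
Qed.

Definition join_sa :=
  Sa [set s : S | tagged s \in sfin (A (tag s))] join_hdK join_reset join_loc.

Lemma sacc_join rho k : (k <= (tw_last rho).+1)%N -> forall l s r,
  sacc (A := join_sa) rho k (@inS l s) r <-> sacc (A := A l) rho k s r.
Proof.
move: k; apply: backward_ind => [l s r|k kn IH l s r].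
  by rewrite /sacc !acc_last inE.
rewrite /sacc !accS //= /dl teval_map /=.
by apply: teval_ext => p _; apply: IH.
Qed.

End Join.

Lemma def_join (I : finType) (P : I -> tword R Gamma -> nat -> Prop) :
  (forall l, def (P l)) -> dfam P.
Proof.
move=> dP; pose A l := fsa (dP l).
exists (join_sa A) (fun l a => tmap (Tagged (fun l => sloc (A l))) (fent (dP l)
  tt a)).
  move=> l a; apply: pure_map (fpure (dP l) tt a) => s /= hs.
  by rewrite /= hs.
move=> l rho i lei; rewrite (fspec (dP l) tt) // /entry_sat teval_map.
by apply: teval_ext => // q _; apply: iff_sym; apply: sacc_join.
Qed.

Lemma def_ex (I : finType) (P : I -> tword R Gamma -> nat -> Prop) :
  (forall l, def (P l)) -> def (fun rho i => exists l, P l rho i).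
Proof.
move/def_join=> [A e pe se]; exists A (fun _ a => tbigor (fun l => e l a)).
  by move=> _ a; apply: pure_bigor.
move=> _ rho i lei; rewrite /entry_sat teval_bigor.
by split=> -[l hl]; exists l; apply/se.
Qed.

Lemma def_and P P' : def P -> def P' -> def (fun rho i => P rho i /\ P' rho i).
Proof.
move=> dP dP'; pose Q (b : bool) rho i := ~ (if b then P else P') rho i.
apply: (@def_ext (fun rho i => ~ exists b, Q b rho i)) => [rho i _|].
  rewrite /Q; split=> [h|[? ?] [[]]//]; split; apply: contrapT => ?; apply: h;
  [by exists true | by exists false].
by apply: def_not; apply: def_ex => -[]; apply: def_not.
Qed.

Definition unit_sa : sa Gamma.
Proof.
by refine (@Sa Gamma unit id (fun=> 0%N) (fun _ _ => TTop _) finset.set0 _ _ _).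
Defined.

Lemma def_letter (p : pred Gamma) : def (fun rho i => p (sg rho i)).
Proof.
exists unit_sa (fun _ a => if p a then TTop _ else TBot _).
  by move=> _ a; case: (p a).
by move=> _ rho i _; rewrite /entry_sat; case: (p _).
Qed.

Lemma def_const (b : Prop) : def (fun _ _ => b).
Proof.
apply: (@def_ext (fun rho i => `[< b >])); first by move=> *; split=> /asboolP.
exact: (def_letter (fun=> `[< b >])).
Qed.

(** * Nondeterministic islands with definable guards *)

Section Island.
Variables (Q C : finType) (G : Q -> C -> tword R Gamma -> nat -> Prop).
Variables (J : Q -> C -> nat_interval) (tgt : Q -> C -> option Q).
Variable fin : {set Q}.

Section IslandSem.
Variables (rho : tword R Gamma) (r : R).

Fixpoint iaccn (m k : nat) (q : Q) : Prop :=
  if m is m'.+1 then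
    exists c, [/\ G q c rho k, tm rho k - r \in itv_of R (J q c)
                & if tgt q c is Some q' then iaccn m' k.+1 q' else True]
  else q \in fin.

(* Acceptance by a nondeterministic one-clock automaton whose edges are guarded
   by predicates on positions; an edge without target accepts at once. *)
Definition iacc (k : nat) (q : Q) : Prop := iaccn ((tw_last rho).+1 - k) k q.

Lemma iacc_last q : iacc (tw_last rho).+1 q = (q \in fin).
Proof. by rewrite /iacc subnn. Qed.

Lemma iaccS k q : (k <= tw_last rho)%N ->
  iacc k q = exists c, [/\ G q c rho k, tm rho k - r \in itv_of R (J q c)
                & if tgt q c is Some q' then iacc k.+1 q' else True].
Proof. by move=> kn; rewrite /iacc subSn. Qed.

End IslandSem.

Section IslandSa.
Variable dG : dfam (fun qc : Q * C => G qc.1 qc.2).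
Variable q0 : Q.
Let A := fsa dG.
(** The header [inl None] duplicates the entry state [q0]: the normal form forbids entering a header
    without a reset, while the island may return to [q0]. Its rank lies above all locations of [A],
    which the guards spawn. *)
Let S : finType := (option Q + sloc A)%type.
Let hd (s : S) : S := match s with inl _ => inl None | inr t => inr (shd t) end.
Let rk (s : S) : nat :=
  match s with inl _ => (\max_t @srk _ A t).+1 | inr t => srk t end.
Let edge (q : Q) (a : Gamma) (c : C) : trans S :=
  TAnd (tmap inr (fent dG (q, c) a)) (TAnd (TClock _ (J q c))
    (if tgt q c is Some q' then TLoc (inl (Some q')) else TTop _)).
Let dl (s : S) (a : Gamma) : trans S :=
  match s with
  | inl oq => tbigor (edge (odflt q0 oq) a)
  | inr t => tmap inr (sdl t a)
  end.

Lemma island_hdK s : hd (hd s) = hd s.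
Proof. by case: s => //= t; rewrite shdK. Qed.

Lemma island_reset s a q : occurs_reset q (dl s a) ->
  hd q = q /\ (rk q < rk (hd s))%N.
Proof.
case: s => [oq|t] /=.
  case/occurs_reset_bigor=> c /=; case: (tgt _ _) => [?|]; rewrite /= orbF;
  case/occurs_reset_map=> p -> /(pure_reset (fpure dG _ _)) /= hp;
  by rewrite hp ltnS; split=> //; exact: leq_bigmax.
by case/occurs_reset_map=> p -> /sdl_reset[hp pr]; rewrite /= hp.
Qed.

Lemma island_loc s a q : occurs_loc q (dl s a) -> hd q = hd s /\ q <> hd s.
Proof.
case: s => [oq|t] /=.
  case/occurs_loc_bigor=> c /= /orP[/occurs_loc_map[p _]|].
    by rewrite (negPf (pure_loc p (fpure dG _ _))).
  by case: (tgt _ _) => //= q' /eqP->.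
case/occurs_loc_map=> p -> /sdl_loc[hp pr]; rewrite /= hp; split=> //.
by case.
Qed.

Definition island_sa :=
  Sa [set s : S | match s with inl oq => odflt q0 oq \in fin | inr t => t \in
    sfin A end]
    island_hdK island_reset island_loc.

Lemma sacc_island_sub rho k : (k <= (tw_last rho).+1)%N -> forall (t : sloc A)
  r,
  sacc (A := island_sa) rho k (inr t) r <-> sacc (A := A) rho k t r.
Proof.
move: k; apply: backward_ind => [t r|k kn IH t r].
  by rewrite /sacc !acc_last inE.
rewrite /sacc !accS //= teval_map /=.
by apply: teval_ext => p _; apply: IH.
Qed.

Lemma sacc_island rho r k : (k <= (tw_last rho).+1)%N -> forall oq,
  sacc (A := island_sa) rho k (inl oq) r <-> iacc rho r k (odflt q0 oq).
Proof.
move: k; apply: backward_ind => [oq|k kn IH oq].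
  by rewrite /sacc acc_last iacc_last inE.
rewrite /sacc accS // iaccS //= teval_bigor.
have sub c : teval (tm rho k - r)
    (fun p => acc dl (sfin island_sa) rho k.+1 p r)
    (fun q => acc dl (sfin island_sa) rho k.+1 q (tm rho k))
    (tmap inr (fent dG (odflt q0 oq, c) (sg rho k))) <->
    G (odflt q0 oq) c rho k.
  rewrite (fspec dG (odflt q0 oq, c)) // teval_map /entry_sat.
  rewrite (teval_pure _ 0 _ (fun=> False) _ (fpure dG _ _)).
  by apply: teval_ext => // p _; apply: sacc_island_sub.
split=> -[c].
  case=> /sub gc [jc tc]; exists c; split=> //.
  by case: (tgt _ _) tc => //= q'; exact: (proj1 (IH (Some q'))).
case=> gc jc tc; exists c; split; first exact/sub.
by split=> //; case: (tgt _ _) tc => //= q'; exact: (proj2 (IH (Some q'))).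
Qed.

End IslandSa.

Lemma def_island : (forall q c, def (G q c)) ->
  forall q, def (fun rho i => iacc rho (tm rho i) i.+1 q).
Proof.
move=> dG q; have dG' : dfam (fun qc : Q * C => G qc.1 qc.2).
  by apply: def_join => -[q1 c1]; exact: dG.
exists (island_sa dG' q) (fun _ _ => TReset (inl None)) => // _ rho i lei.
by rewrite /entry_sat /= sacc_island.
Qed.

End Island.

End Definable.

(** * Definability up to a memory of the current block *)

Section BlockMemory.
Variables (R : realType) (Gamma : finType).
Local Notation ppred := (tword R Gamma -> nat -> Prop).

Definition same_next : ppred :=
  fun rho i => (i < tw_last rho)%N /\ tm rho i.+1 = tm rho i.

(** The island has a single edge, taken at the next position with clock value 0 and accepting at
    once. The empty final set makes it fail at the last position. *)
Lemma def_same_next : def same_next.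
Proof.
apply: def_ext (def_island (G := fun _ _ : unit => (fun _ _ => True) : ppred)
  (fun _ _ => zero_itv) (fun _ _ => None) finset.set0
  (fun _ _ => def_const _ _ True) tt) => rho i lei.
move: lei; rewrite leq_eqVlt => /predU1P[->|lti].
  by rewrite iacc_last inE; split=> // -[]; rewrite ltnn.
rewrite iaccS //; split=> [[_ [_ + _]]|[_ e]]; last first.
  by exists tt; rewrite mem_zero_itv e subrr.
by rewrite mem_zero_itv subr_eq0 => /eqP.
Qed.

Definition block_start (rho : tword R Gamma) (i : nat) : bool :=
  if i is j.+1 then tm rho j.+1 != tm rho j else true.

Fixpoint block_first (rho : tword R Gamma) (i : nat) : nat :=
  if i is j.+1 then if tm rho j.+1 == tm rho j then block_first rho j else i
  else 0%N.

(* A block is a maximal set of consecutive positions with equal time stamps.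
   The memory is constant on blocks, and at the start of a block its value can
   be determined by looking at the future only. *)
Record memory := Memory {
  mval : finType;
  mstate : tword R Gamma -> nat -> mval;
  mtest : mval -> ppred;
  mtest_def : forall v, def (mtest v);
  mstate_block : forall rho i, same_next rho i -> mstate rho i.+1 = mstate rho
    i;
  mtestP : forall rho i v, (i <= tw_last rho)%N -> block_start rho i ->
    mtest v rho i <-> mstate rho i = v
}.

(** The memory is a parameter because bodies can be combined only over the same memory; [bdef_join]
    provides a common one. *)
Record mdef (M : memory) (P : ppred) := Mdef {
  mbody : mval M -> ppred;
  mbody_def : forall v, def (mbody v);
  mbodyP : forall rho i, (i <= tw_last rho)%N ->
    P rho i <-> mbody (mstate M rho i) rho i
}.

Definition bdef (P : ppred) := {M : memory & mdef M P}.

Lemma mdef_ext M (P P' : ppred) :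
  (forall rho i, (i <= tw_last rho)%N -> P rho i <-> P' rho i) ->
  mdef M P -> mdef M P'.
Proof.
by move=> hP [D dD sD]; exists D => // rho i lei; rewrite -hP // sD.
Qed.

Lemma bdef_ext (P P' : ppred) :
  (forall rho i, (i <= tw_last rho)%N -> P rho i <-> P' rho i) ->
  bdef P -> bdef P'.
Proof. by move=> hP [M /(mdef_ext hP)]; exists M. Qed.

Lemma mdef_def M P : def P -> mdef M P.
Proof. by move=> dP; exists (fun=> P). Qed.

Lemma mdef_not M P : mdef M P -> mdef M (fun rho i => ~ P rho i).
Proof.
case=> D dD sD; exists (fun v rho i => ~ D v rho i) => [v|rho i lei].
  exact: def_not.
by rewrite sD.
Qed.

Lemma mdef_and M P P' :
  mdef M P -> mdef M P' -> mdef M (fun rho i => P rho i /\ P' rho i).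
Proof.
case=> D dD sD [D' dD' sD'].
exists (fun v rho i => D v rho i /\ D' v rho i) => [v|rho i lei].
  exact: def_and.
by rewrite sD // sD'.
Qed.

Lemma mdef_ex M (I : finType) (P : I -> ppred) :
  (forall l, mdef M (P l)) -> mdef M (fun rho i => exists l, P l rho i).
Proof.
move=> dP; exists (fun v rho i => exists l, mbody (dP l) v rho i).
  by move=> v; apply: def_ex => l; exact: mbody_def.
by move=> rho i lei; split=> -[l hl]; exists l; apply/(mbodyP (dP l)).
Qed.

Lemma def_all (I : finType) (P : I -> ppred) :
  (forall l, def (P l)) -> def (fun rho i => forall l, P l rho i).
Proof.
move=> dP; apply: (@def_ext _ _ (fun rho i => ~ exists l, ~ P l rho i)).
  by move=> rho i _; rewrite -forallNP; split=> h l;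
    [apply: contrapT | move=> /(_ (h l))].
by apply: def_not; apply: def_ex => l; apply: def_not.
Qed.

Lemma def_if (b : bool) (P P' : ppred) :
  def P -> def P' -> def (fun rho i => if b then P rho i else P' rho i).
Proof. by case: b. Qed.

Section JoinMemory.
Variables (I : finType) (M : I -> memory).
Let V : finType := {dffun forall l : I, mval (M l)}.
Let jmem (rho : tword R Gamma) (i : nat) : V :=
  [ffun l => mstate (M l) rho i] : {dffun forall l : I, mval (M l)}.
Let jtest (v : V) : ppred :=
  fun rho i => forall l, mtest (v l) rho i.

Definition join_memory : memory.
Proof.
refine (@Memory V jmem jtest _ _ _).
- by move=> v; apply: def_all => l; exact: mtest_def.
- by move=> rho i h; apply/ffunP => l; rewrite !ffunE mstate_block.
- move=> rho i v lei fi; split=> [h|<- l]; last by apply/mtestP; rewrite ?ffunE.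
  by apply/ffunP=> l; rewrite ffunE; apply/mtestP.
Defined.

Lemma mdef_join P l : mdef (M l) P -> mdef join_memory P.
Proof.
case=> D dD sD; exists (fun v : V => D (v l)) => [v|rho i lei]; first exact: dD.
by rewrite sD //= ffunE.
Qed.

End JoinMemory.

Lemma bdef_join (I : finType) (P : I -> ppred) :
  (forall l, bdef (P l)) -> {M : memory & forall l, mdef M (P l)}.
Proof.
move=> dP; exists (join_memory (fun l => projT1 (dP l))) => l.
exact: (mdef_join (projT2 (dP l))).
Qed.

Definition trivial_memory : memory.
Proof.
refine (@Memory unit (fun _ _ => tt) (fun _ _ _ => True) _ _ _) => //.
  by move=> _; exact: def_const.
by move=> rho i [].
Defined.

Lemma bdef_def P : def P -> bdef P.
Proof. by move=> dP; exists trivial_memory; exact: mdef_def. Qed.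

Lemma bdef_not P : bdef P -> bdef (fun rho i => ~ P rho i).
Proof. by case=> M /mdef_not; exists M. Qed.

Lemma bdef_and P P' : bdef P -> bdef P' -> bdef (fun rho i => P rho i /\ P' rho
  i).
Proof.
move=> dP dP'.
have [|M dM] := @bdef_join bool (fun b => if b then P else P'); first by case.
by exists M; apply: mdef_and; [exact: (dM true) | exact: (dM false)].
Qed.

Section MemoryIsland.
Variables (M : memory) (Q C : finType) (G : Q -> C -> ppred).
Variables (J : Q -> C -> nat_interval) (tgt : Q -> C -> option Q).
Variable fin : {set Q}.
Variable dG : forall q c, mdef M (G q c).

Let Q' : finType := (Q * mval M * bool)%type.
Let C' : finType := (C * mval M * bool)%type.
(* A state additionally carries the memory of the last position read and
   whether the next position is in the same block. *)
Let G' (q : Q') (c : C') : ppred := fun rho k =>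
  (if q.2 then c.1.2 = q.1.2 else mtest c.1.2 rho k) /\
  (mbody (dG q.1.1 c.1.1) c.1.2 rho k /\
   (if c.2 then same_next rho k else ~ same_next rho k)).
Let J' (q : Q') (c : C') := J q.1.1 c.1.1.
Let tgt' (q : Q') (c : C') : option Q' :=
  omap (fun q' => (q', c.1.2, c.2)) (tgt q.1.1 c.1.1).
Let fin' : {set Q'} := [set q | q.1.1 \in fin].

Lemma def_memory_guard q c : def (G' q c).
Proof.
apply: def_and; first by apply: def_if; [exact: def_const | exact: mtest_def].
apply: def_and; first exact: mbody_def.
by apply: def_if; [exact: def_same_next | apply: def_not; exact: def_same_next].
Qed.

(** All guesses are forced: the flag is checked by [same_next], and the memory value either equals
    the carried one inside a block or passes the test at a block start. Every guard is thus
    evaluated with the body for the true memory value. *)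
Lemma iacc_memory rho r k : (k <= (tw_last rho).+1)%N -> (0 < k)%N -> forall q,
  iacc G' J' tgt' fin' rho r k (q, mstate M rho k.-1, `[< same_next rho k.-1
    >]) <->
  iacc G J tgt fin rho r k q.
Proof.
move: k; apply: backward_ind => [_ q|[//|k] kn IH _ q].
  by rewrite !iacc_last inE.
have {}IH q' := IH isT q'; rewrite !iaccS //=.
have memk v : (if `[< same_next rho k >] then v = mstate M rho k
    else mtest v rho k.+1) <-> v = mstate M rho k.+1.
  case: asboolP => [/mstate_block->//|nk]; rewrite mtestP //.
    by split=> ->.
  by apply/eqP => e; apply: nk; split.
split=> [[[[c v] b] /= [[/memk /= ev [Dc hb]] jc tc]]|[c [gc jc tc]]].
  have eb : b = `[< same_next rho k.+1 >].
    by case: b hb {Dc jc tc} => hb; [rewrite asboolT | rewrite asboolF].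
  exists c; split=> //; first by apply/(mbodyP (dG q c)); rewrite // -ev.
  by move: tc; rewrite /tgt' /= eb ev; case: (tgt q c) => //= q';
    exact: (proj1 (IH q')).
exists (c, mstate M rho k.+1, `[< same_next rho k.+1 >]); split=> //=.
  split=> /=; first exact/memk.
  by split; [apply/(mbodyP (dG q c)) | case: asboolP].
by rewrite /tgt' /=; case: (tgt q c) tc => //= q'; exact: (proj2 (IH q')).
Qed.

Lemma mdef_island q : mdef M (fun rho i => iacc G J tgt fin rho (tm rho i) i.+1
  q).
Proof.
(* The memory at [i] is the argument [v] of the body, so only the flag about the next position has
   to be guessed on entry. *)
exists (fun v rho i => exists b : bool,
    (if b then same_next rho i else ~ same_next rho i) /\
    iacc G' J' tgt' fin' rho (tm rho i) i.+1 (q, v, b)).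
  move=> v; apply: def_ex => b; apply: def_and; last first.
    by apply: def_island => *; exact: def_memory_guard.
  by apply: def_if; [exact: def_same_next | apply: def_not;
    exact: def_same_next].
move=> rho i lei; rewrite -iacc_memory //=.
split=> [h|[b [hb]]]; first by eexists; split; last exact: h; case: asboolP.
suff -> : `[< same_next rho i >] = b by [].
by case: b hb => hb; [rewrite asboolT | rewrite asboolF].
Qed.

End MemoryIsland.

Lemma block_first_le rho i : (block_first rho i <= i)%N.
Proof. by elim: i => //= i IHi; case: eqP => // _; apply: leqW. Qed.

Lemma tm_block_first rho i : tm rho (block_first rho i) = tm rho i.
Proof. by elim: i => //= i IHi; case: eqP => // ->. Qed.

Lemma block_start_first rho i : block_start rho (block_first rho i).
Proof. by elim: i => //= i IHi; case: eqP => //= /eqP. Qed.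

Lemma block_first_start rho i : block_start rho i -> block_first rho i = i.
Proof. by case: i => //= i /negPf->. Qed.

(** The truth of [P] at the start of the block becomes a new component of the memory. It must be
    testable only at block starts, where [block_first] is the identity and the old memory can be
    tested as well, so the body of [P] for the tested value decides it. *)
Lemma bdef_block_first P : bdef P -> bdef (fun rho i => P rho (block_first rho
  i)).
Proof.
case=> M [D dD sD].
pose V : finType := (mval M * bool)%type.
have mb : forall v : V, def (fun rho i => mtest v.1 rho i /\
    (if v.2 then D v.1 rho i else ~ D v.1 rho i)).
  move=> v; apply: def_and; first exact: mtest_def.
  by apply: def_if => //; apply: def_not.
pose m (rho : tword R Gamma) i : V :=
  (mstate M rho i, `[< P rho (block_first rho i) >]).
have mconst rho i : same_next rho i -> m rho i.+1 = m rho i.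
  by move=> hi; rewrite /m mstate_block //= (proj2 hi) eqxx.
have mP rho i v : (i <= tw_last rho)%N -> block_start rho i ->
    (mtest v.1 rho i /\ (if v.2 then D v.1 rho i else ~ D v.1 rho i)) <->
    m rho i = v.
  case: v => v b lei fi; rewrite /= mtestP // /m block_first_start //.
  split=> [[<-]|[<- <-]].
    by case: b; rewrite -sD // => hb; [rewrite asboolT | rewrite asboolF].
  by split=> //; case: asboolP; rewrite sD.
exists (Memory mb mconst mP).
exists (fun (v : V) _ _ => is_true v.2) => [v|rho i lei];
  first exact: def_const.
by rewrite /=; split=> /asboolP.
Qed.

End BlockMemory.

(** * Regular expressions as automata *)

(* Right-to-left deterministic recognizers: with [foldr], concatenation and
   star are handled by sets of states. *)
Record recog (X : Type) (L : seq X -> Prop) := Recog {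
  rst : finType;
  rstep : X -> rst -> rst;
  rnil : rst;
  racc : pred rst;
  recogP : forall w, L w <-> racc (foldr rstep rnil w)
}.

Section RegexRecog.
Variable X : eqType.
Implicit Types (L : seq X -> Prop) (w : seq X).

Lemma cat_cons_split (x : X) w u v : x :: w = u ++ v <->
  (u = [::] /\ v = x :: w) \/ exists2 u', u = x :: u' & w = u' ++ v.
Proof.
case: u => [|y u] /=; split.
- by move=> <-; left.
- by case=> [[_ ->]|[]].
- by case=> <- ->; right; exists u.
- by case=> [[]//|[u' [-> ->] ->]].
Qed.

(** Besides the second recognizer's state on [w], the new state holds the values of the first
    recognizer on all prefixes of [w] whose remaining suffix is in [L2]. *)
Lemma recog_cat L1 L2 : recog L1 -> recog L2 ->
  recog (fun w => exists u v, [/\ w = u ++ v, L1 u & L2 v]).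
Proof.
case=> Q1 g1 r1 F1 s1 [Q2 g2 r2 F2 s2].
pose ini q2 := if F2 q2 then [set r1] else finset.set0.
pose g x (p : {set Q1} * Q2) :=
  ([set g1 x q | q in p.1] :|: ini (g2 x p.2), g2 x p.2).
pose r := (ini r2, r2).
have fold2 w : (foldr g r w).2 = foldr g2 r2 w by elim: w => //= x w ->.
have iniP q q2 : (q \in ini q2) <-> F2 q2 /\ q = r1.
  rewrite /ini; case: (F2 q2); rewrite inE; last by split=> // -[].
  by split=> [/eqP|[_ ->]].
have fold1 w q : q \in (foldr g r w).1 <->
    exists u v, [/\ w = u ++ v, foldr g1 r1 u = q & F2 (foldr g2 r2 v)].
  elim: w q => [|x w IHw] q /=.
    rewrite iniP; split=> [[h ->]|[[|? ?] [[|? ?] [//= _ <- h]]]] //.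
    by exists [::], [::].
  rewrite inE fold2; split.
    case/orP=> [/imsetP[q' /IHw[u [v [-> <- hv]]] ->]|/iniP[h ->]].
      by exists (x :: u), v.
    by exists [::], (x :: w).
  case=> u [v [/cat_cons_split + <- h]] => -[[-> ev]|[u' -> ew]].
    by apply/orP; right; apply/iniP; move: h; rewrite ev.
  by apply/orP; left; apply/imset_f/IHw; exists u', v.
exists _ g r (fun p : {set Q1} * Q2 => [exists q in p.1, F1 q]) => w; split.
  case=> u [v [-> /s1 h1 /s2 h2]]; apply/exists_inP.
  by exists (foldr g1 r1 u) => //; apply/fold1; exists u, v.
case/exists_inP=> q /fold1[u [v [-> <- h2]]] h1; exists u, v.
by split=> //; [apply/s1 | apply/s2].
Qed.

Definition star L w :=
  exists2 us : seq (seq X), w = flatten us & forall u, u \in us -> L u.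

Lemma star_nil L : star L [::].
Proof. by exists [::]. Qed.

Lemma star_cons L x w :
  star L (x :: w) <-> exists u v, [/\ w = u ++ v, L (x :: u) & star L v].
Proof.
split=> [[us]|[u [v [-> Lu [us -> hus]]]]]; last first.
  exists ((x :: u) :: us) => // u'; rewrite inE => /predU1P[->//|]; exact: hus.
elim: us => [//|[|y u] us IHus] /=.
  by move=> /IHus{}IHus h; apply: IHus => u uus; apply: h; rewrite inE uus orbT.
case=> <- -> h; exists u, (flatten us); split=> //.
  by apply: h; rewrite inE eqxx.
by exists us => // u' uus; apply: h; rewrite inE uus orbT.
Qed.

(** The set holds the values on all prefixes of [w] whose remaining suffix is in the star, and the
    flag tells whether [w] is. The flag is separate because the empty word is in the star even when
    [F1 r1] fails. *)
Lemma recog_star L : recog L -> recog (star L).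
Proof.
case=> Q1 g1 r1 F1 s1.
pose nx x (A : {set Q1}) := [set g1 x q | q in A].
pose ok (A : {set Q1}) := [exists q in A, F1 q].
(* [ok] is applied before [r1] is added, so the first factor is nonempty, as in [star_cons]. *)
pose g x (p : {set Q1} * bool) :=
  (nx x p.1 :|: (if ok (nx x p.1) then [set r1] else finset.set0), ok (nx x
    p.1)).
pose r := ([set r1], true).
have inv w : (forall q, q \in (foldr g r w).1 <->
      exists u v, [/\ w = u ++ v, foldr g1 r1 u = q & star L v]) /\
    ((foldr g r w).2 <-> star L w).
  elim: w => [|x w [IHw _]] /=.
    split=> [q|]; last by split=> // _; exact: star_nil.
    rewrite inE; split=> [/eqP->|[[|? ?] [[|? ?] [//= _ <- _]]]] //.
    by exists [::], [::]; split=> //; exact: star_nil.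
  have okP : ok (nx x (foldr g r w).1) <-> star L (x :: w).
    rewrite star_cons; split.
      case/exists_inP=> _ /imsetP[q /IHw[u [v [ew <- hv]]] ->] hF.
      by exists u, v; split=> //; apply/s1.
    case=> u [v [ew /s1 hu hv]]; apply/exists_inP;
      exists (g1 x (foldr g1 r1 u)) => //.
    by apply/imset_f/IHw; exists u, v.
  split=> [q|//]; rewrite inE; split.
    case/orP=> [/imsetP[q' /IHw[u [v [-> <- hv]]] ->]|].
      by exists (x :: u), v.
    case: ifP => [/okP h|_]; rewrite inE // => /eqP->.
    by exists [::], (x :: w).
  case=> u [v [/cat_cons_split + <- h]] => -[[-> ev]|[u' -> ew]].
    by move: h; rewrite ev => /okP ->; rewrite inE /= eqxx orbT.
  by apply/orP; left; apply/imset_f/IHw; exists u', v.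
by exists _ g r (fun p : {set Q1} * bool => p.2) => w; have [_ ->] := inv w.
Qed.

Lemma recog_all : recog (fun _ : seq X => True).
Proof. by exists unit (fun _ _ => tt) tt (fun=> true). Qed.

Lemma recog_regex (re : regex X) : recog (re_lang re).
Proof.
elim: re => [|x|r1 IH1 r2 IH2|r1 IH1 r2 IH2|r1 IH1].
- exists bool (fun _ _ => false) true id => w.
  by case: w => [|x w] /=; split=> //.
(* [Some false] stands for the empty word, [Some true] for the word [[:: x]], and [None] for all
   other words. *)
- pose f (y : X) s := if s == Some false then
      if y == x then Some true else None else None.
  have nf t s : (f t s == Some false) = false.
    by rewrite /f; case: ifP => // _; case: ifP.
  exists (option bool) f (Some false) (pred1 (Some true)) => -[|y [|z w]] /=.
  + by split.
  + rewrite /f eqxx; split=> [[->]|]; first by rewrite eqxx.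
    by case: (y =P x) => // ->.
  + by rewrite {1}/f nf; split.
- exact: recog_cat.
- case: IH1 IH2 => Q1 g1 r1' F1 s1 [Q2 g2 r2' F2 s2].
  exists (Q1 * Q2)%type (fun x p => (g1 x p.1, g2 x p.2)) (r1', r2')
    (fun p : Q1 * Q2 => F1 p.1 || F2 p.2) => w.
  have -> : foldr (fun x p => (g1 x p.1, g2 x p.2)) (r1', r2') w =
      (foldr g1 r1' w, foldr g2 r2' w) by elim: w => //= x w ->.
  by split=> [[/s1->|/s2->]|/orP[/s1|/s2]]; rewrite ?orbT //; [left|right].
- exact: recog_star.
Qed.

End RegexRecog.

Section Matching.
Variable X : Type.

Definition matches (T : X -> nat -> Prop) (w : seq X) (l : seq nat) : bool :=
  all2 (fun x k => `[< T x k >]) w l.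

Lemma matches_nil T w : matches T w [::] -> w = [::].
Proof. by case: w. Qed.

Lemma matches_cons T w k l : matches T w (k :: l) <->
  exists x w', [/\ w = x :: w', T x k & matches T w' l].
Proof.
case: w => [|x w] /=; first by split=> // -[x [w []]].
split=> [/andP[/asboolP hx hw]|[y [w' [[-> ->] hy hw]]]]; first by exists x, w.
by apply/andP; split=> //; apply/asboolP.
Qed.

End Matching.
Arguments matches : simpl never.

(** * Islands for [FRat] and [Rat] *)

Section FormulaIslands.
Variables (R : realType) (Gamma : finType).
Local Notation ppred := (tword R Gamma -> nat -> Prop).
Variables (X : finType) (T : X -> ppred) (J : nat_interval).
Variables (Q : finType) (g : X -> Q -> Q) (q0 : Q).

Section FRat.
Variable phi : ppred.

(** The island runs the recognizer against its direction: [q] predicts the value of [foldr g q0] on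
    the labels still to come, an edge replaces it by some [q'] with [q = g x q'], and at the
    position of [phi] the prediction must be [q0]. The free choice of [x] accounts for [single]. *)
Let G (q : Q) (c : option (X * Q)) : ppred := fun rho k =>
  if c is Some (x, q') then q = g x q' /\ T x rho k else q = q0 /\ phi rho k.
Let K (q : Q) (c : option (X * Q)) := if c is Some _ then full_itv else J.
Let tgt (q : Q) (c : option (X * Q)) : option Q := omap snd c.

Lemma iacc_frat rho r k : (k <= (tw_last rho).+1)%N ->
  (forall j, (k <= j <= tw_last rho)%N -> r <= tm rho j) -> forall q,
  iacc G K tgt finset.set0 rho r k q <->
  exists j w, [/\ (k <= j <= tw_last rho)%N, phi rho j,
    tm rho j - r \in itv_of R J,
    matches (fun x => T x rho) w (iota k (j - k)) & q = foldr g q0 w].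
Proof.
move: k; apply: backward_ind => [_ q|k kn IH hr q].
  rewrite iacc_last inE; split=> // -[j [w [h _ _ _ _]]]; lia.
have {}IH := IH (fun j jk => hr j ltac:(lia)).
have r0 : 0 <= tm rho k - r by rewrite subr_ge0 hr // leqnn.
rewrite iaccS //; split.
  case=> -[[x q'] [[-> Tx] _ /= /IH[j [w [/andP[jk jn] pj rj wj ->]]]]|[[-> pk]
    rk _]].
    exists j, (x :: w); split=> //; first by rewrite ltnW.
    by rewrite -(subnSK jk); apply/matches_cons; exists x, w.
  by exists k, [::]; rewrite subnn leqnn.
case=> j [w [/andP[kj jn] pj rj]]; move: kj;
  rewrite leq_eqVlt => /predU1P[kj|kj].
  rewrite -kj subnn => /matches_nil -> ->; exists None; rewrite /= kj.
  by split.
rewrite -(subnSK kj); case/matches_cons=> x [w' [-> Tx ww]] ->;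
  exists (Some (x, foldr g q0 w')).
split=> //; first exact: mem_full_itv.
by apply/IH; exists j, w'; split=> //; lia.
Qed.

Lemma mdef_frat M (Fin : pred Q) : (forall x, mdef M (T x)) -> mdef M phi ->
  mdef M (fun rho i => exists j w, [/\ (i < j <= tw_last rho)%N, phi rho j,
    tm rho j - tm rho i \in itv_of R J,
    matches (fun x => T x rho) w (iota i.+1 (j - i.+1)) & Fin (foldr g q0 w)]).
Proof.
move=> dT dphi.
apply: (@mdef_ext _ _ _ (fun rho i => exists q,
    Fin q /\ iacc G K tgt finset.set0 rho (tm rho i) i.+1 q)).
  move=> rho i lei.
  have hr j : (i.+1 <= j <= tw_last rho)%N -> tm rho i <= tm rho j.
    by move=> ij; apply: tm_mono; lia.
  split=> [[q [Fq /(@iacc_frat rho _ i.+1 lei hr)[j [w [ij pj rj wj qw]]]]]|].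
    by exists j, w; rewrite -qw.
  case=> j [w [ij pj rj wj Fw]]; exists (foldr g q0 w); split=> //.
  by apply/iacc_frat => //; exists j, w.
apply: mdef_ex => q; apply: mdef_and; first by apply: mdef_def;
  exact: def_const.
apply: mdef_island => q1 [[x q2]|]; apply: mdef_and => //;
  by apply: mdef_def; exact: def_const.
Qed.

End FRat.

Section Rat.

(** The predictions are those of the [FRat] island, now settled at the end of the word by the final
    set [[set q0]]. The edges [inr] skip positions outside [J], one for each side of the
    interval. *)
Let G (q : Q) (c : X * Q + bool) : ppred := fun rho k =>
  if c is inl (x, q') then q = g x q' /\ T x rho k else True.
Let K (q : Q) (c : X * Q + bool) :=
  match c with inl _ => J | inr b => if b then below J else above J end.
Let tgt (q : Q) (c : X * Q + bool) : option Q :=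
  Some (match c with inl (_, q') => q' | inr _ => q end).

Lemma iacc_rat rho r k : (k <= (tw_last rho).+1)%N ->
  (forall j, (k <= j <= tw_last rho)%N -> r <= tm rho j) -> forall q,
  iacc G K tgt [set q0] rho r k q <->
  exists w, matches (fun x => T x rho) w
      [seq j <- rng rho k | tm rho j - r \in itv_of R J] /\ q = foldr g q0 w.
Proof.
move: k; apply: backward_ind => [_ q|k kn IH hr q].
  rewrite iacc_last rng_last inE; split=> [/eqP->|[w [/matches_nil -> ->]]//].
  by exists [::].
have {}IH := IH (fun j jk => hr j ltac:(lia)).
have r0 : 0 <= tm rho k - r by rewrite subr_ge0 hr // leqnn.
rewrite iaccS // rngS //=; have := not_mem_itv_of J r0.
case: ifP => rJ /= nJ; split.
- case=> -[[x q']|b] [/= + rk]; last first.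
    by case: b rk nJ => ->; rewrite ?orbT.
  case=> -> Tx /IH[w [wj ->]]; exists (x :: w); split=> //.
  by apply/matches_cons; exists x, w.
- case=> w [/matches_cons[x [w' [-> Tx ww]]] ->].
  exists (inl (x, foldr g q0 w')); split=> //.
  by apply/IH; exists w'.
- case=> -[[x q']|b] [/= + rk]; first by rewrite rk in rJ.
  by move=> _ /IH.
- move=> /IH h; case/orP: nJ => rk; [exists (inr true) | exists (inr false)];
  by split.
Qed.

(** Only positions from [i] on are taken into account; by [filter_rng_block] these make up the whole
    segment when [i] starts a block. *)
Lemma mdef_rat M (Fin : pred Q) : (forall x, mdef M (T x)) ->
  mdef M (fun rho i => exists w, matches (fun x => T x rho) w
      [seq j <- rng rho i | tm rho j - tm rho i \in itv_of R J] /\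
      Fin (foldr g q0 w)).
Proof.
move=> dT; pose I q rho i := iacc G K tgt [set q0] rho (tm rho i) i.+1 q.
have dI q : mdef M (I q).
  apply: mdef_island => q1 [[x q2]|b]; last by apply: mdef_def;
    exact: def_const.
  by apply: mdef_and => //; apply: mdef_def; exact: def_const.
have hr (rho : tword R Gamma) i : (i <= tw_last rho)%N ->
    forall j, (i.+1 <= j <= tw_last rho)%N -> tm rho i <= tm rho j.
  by move=> lei j ij; apply: tm_mono; lia.
(* The island reads from [i.+1] on, so when 0 is in [J] the label of [i] itself is checked outside
   it. *)
have [J0|J0] := boolP (0 \in itv_of R J).
  apply: (@mdef_ext _ _ _ (fun rho i => exists qx : Q * X,
      Fin (g qx.2 qx.1) /\ (T qx.2 rho i /\ I qx.1 rho i))).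
    move=> rho i lei; rewrite rngS //= subrr J0 /=; split.
      case=> -[q x] [/= Fq [Tx /(@iacc_rat rho _ i.+1 lei (hr _ _ lei))[w [wj
        qw]]]].
      exists (x :: w); rewrite /= -qw; split=> //.
      by apply/matches_cons; exists x, w.
    case=> _ [/matches_cons[x [w [-> Tx ww]]] Fw].
    exists (foldr g q0 w, x); split=> //; split=> //.
    by apply/(@iacc_rat rho _ i.+1 lei (hr _ _ lei)); exists w.
  apply: mdef_ex => -[q x]; apply: mdef_and; first by apply: mdef_def;
    exact: def_const.
  exact: mdef_and.
apply: (@mdef_ext _ _ _ (fun rho i => exists q, Fin q /\ I q rho i)).
  move=> rho i lei; rewrite rngS //= subrr (negPf J0) /=; split.
    case=> q [Fq /(@iacc_rat rho _ i.+1 lei (hr _ _ lei))[w [wj qw]]].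
    by exists w; rewrite -qw.
  case=> w [ww Fw]; exists (foldr g q0 w); split=> //.
  by apply/(@iacc_rat rho _ i.+1 lei (hr _ _ lei)); exists w.
apply: mdef_ex => q; apply: mdef_and => //; by apply: mdef_def;
  exact: def_const.
Qed.

End Rat.

End FormulaIslands.

(** * From formulas to automata *)

Section NatSat.
Variables (R : realType) (Sigma : finType).

Definition nsat (phi : ratmtl Sigma) (rho : tword R (letter Sigma)) (k : nat)
    : Prop := sat phi (inord k : pos rho).

Variable rho : tword R (letter Sigma).

Lemma ratmtl_langE phi : ratmtl_lang R phi rho <-> nsat phi rho 0.
Proof.
rewrite /nsat (_ : inord 0 = ord0) //.
by apply: val_inj; rewrite /= inordK.
Qed.

Lemma single_matches n (h : 'I_n -> pos rho -> Prop) w (l : seq nat) :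
  single [seq true_at h k | k <- [seq inord k | k <- l]] w <->
  matches (fun x k => h x (inord k)) w l.
Proof.
rewrite /single /=; elim: l w => [|k l IHl] [|x w] //=.
rewrite matches_cons inE; split=> [/andP[/asboolP hx /IHl hw]|];
  first by exists x, w.
by case=> y [v [[-> ->] hy /IHl hv]]; apply/andP; split=> //; apply/asboolP.
Qed.

Lemma filter_rng_between i j : (i < j <= tw_last rho)%N ->
  [seq k <- rng rho 0 | (i < k < j)%N] = iota i.+1 (j - i.+1).
Proof.
move=> /andP[ij jn]; rewrite /rng subn0.
have -> : (tw_last rho).+1 = (i.+1 + (j - i.+1) + ((tw_last rho).+1 - j))%N by
  lia.
rewrite !iotaD !filter_cat !add0n -catA.
rewrite [X in X ++ _ ++ _](_ : _ = [::]); last first.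
  by apply/eqP; rewrite -[_ == _]negbK -has_filter; apply/hasPn => k;
     rewrite mem_iota; lia.
rewrite cat0s [X in _ ++ X](_ : _ = [::]) ?cats0; last first.
  by apply/eqP; rewrite -[_ == _]negbK -has_filter; apply/hasPn => k;
     rewrite mem_iota; lia.
by apply/all_filterP/allP => k; rewrite mem_iota; lia.
Qed.

Lemma Seg_matches n (h : 'I_n -> pos rho -> Prop) w (i j : pos rho) :
  (i < j)%N -> single (Seg h i j) w <->
  matches (fun x k => h x (inord k)) w (iota i.+1 (j - i.+1)).
Proof.
move=> ij; rewrite -filter_rng_between; last by have := ltn_ord j; lia.
rewrite -single_matches /Seg enum_pos filter_map.
set a := filter _ _; set b := filter _ _; suff -> : a = b by [].
by apply: eq_in_filter => k; rewrite mem_rng => kn /=; rewrite inordK.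
Qed.

Lemma TSeg_matches n (h : 'I_n -> pos rho -> Prop) w J (i : pos rho) :
  single (TSeg h J i) w <->
  matches (fun x k => h x (inord k)) w
    [seq k <- rng rho 0 | tm rho k - tm rho i \in itv_of R J].
Proof. by rewrite -single_matches /TSeg enum_pos filter_map tm_val. Qed.

Lemma nsat_frat J n (F : 'I_n -> ratmtl Sigma) re phi i : (i <= tw_last rho)%N
  ->
  nsat (MFRat J F re phi) rho i <->
  exists j w, [/\ (i < j <= tw_last rho)%N, nsat phi rho j,
    tm rho j - tm rho i \in itv_of R J,
    matches (fun x => nsat (F x) rho) w (iota i.+1 (j - i.+1))
    & re_lang re w].
Proof.
move=> lei; split.
  case=> j [ij pj tj [w [/(Seg_matches _ _ ij) wm wr]]].
  exists j, w; rewrite inordK // in ij wm;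
    rewrite ij -ltnS ltn_ord /nsat inord_val.
  by rewrite tm_val.
case=> j [w [/andP[ij jn] pj tj wm wr]]; exists (inord j).
have ij' : ((inord i : pos rho) < (inord j : pos rho))%N by rewrite !inordK //;
  lia.
split=> //; exists w; split=> //; apply/Seg_matches => //.
by rewrite !inordK //; lia.
Qed.

Lemma nsat_until J phi psi i : (i <= tw_last rho)%N ->
  nsat (MUntil J phi psi) rho i <->
  exists j w, [/\ (i < j <= tw_last rho)%N, nsat psi rho j,
    tm rho j - tm rho i \in itv_of R J &
    matches (fun _ : unit => nsat phi rho) w (iota i.+1 (j - i.+1))].
Proof.
move=> lei.
have mall l : (exists w, matches (fun _ : unit => nsat phi rho) w l) <->
    forall k, k \in l -> nsat phi rho k.
  elim: l => [|k l IHl]; first by split=> // _; exists [::].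
  split=> [[_ /matches_cons[x [w [_ pk wl]]] k']|h].
    rewrite inE => /predU1P[->//|]; by move: k'; apply/IHl; exists w.
  have /IHl[w wl] : forall k', k' \in l -> nsat phi rho k'.
    by move=> k' kl; apply: h; rewrite inE kl orbT.
  exists (tt :: w); apply/matches_cons; exists tt, w; split=> //.
  by apply: h; rewrite inE eqxx.
split.
  case=> j [ij pj tj hk].
  have [|w hw] := proj2 (mall (iota i.+1 (j - i.+1))).
    move=> k; rewrite mem_iota => kij; rewrite inordK // in ij.
    by have jn := ltn_ord j; apply: hk; rewrite !inordK //; lia.
  exists j, w; rewrite inordK // in ij; rewrite ij -ltnS ltn_ord /nsat
    inord_val.
  by rewrite tm_val.
case=> j [w [/andP[ij jn] pj tj wm]]; exists (inord j).
have {}wm : forall k, k \in iota i.+1 (j - i.+1) -> nsat phi rho k.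
  by apply/mall; exists w.
split=> // [|k]; first by rewrite !inordK //; lia.
rewrite !inordK; try lia; move=> kij.
by have := wm k; rewrite mem_iota /nsat inord_val; apply; lia.
Qed.

Lemma nsat_rat J n (F : 'I_n -> ratmtl Sigma) re i : (i <= tw_last rho)%N ->
  nsat (MRat J F re) rho i <->
  exists w, matches (fun x => nsat (F x) rho) w
    [seq k <- rng rho 0 | tm rho k - tm rho i \in itv_of R J] /\ re_lang re w.
Proof.
move=> lei; split=> -[w [wm wr]]; exists w; split=> //.
  by move/TSeg_matches: wm; rewrite inordK.
by apply/TSeg_matches; rewrite inordK.
Qed.

Lemma tm_lt_block_first i k : (i <= tw_last rho)%N ->
  (k < block_first rho i)%N -> tm rho k < tm rho i.
Proof.
move=> lei; rewrite -(tm_block_first rho i).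
have := block_first_le rho i; have := block_start_first rho i.
case: (block_first rho i) => //= b neq lb kb.
have hb : tm rho b < tm rho b.+1.
  by rewrite lt_neqAle eq_sym neq tm_mono //; lia.
by apply: le_lt_trans hb; apply: tm_mono; lia.
Qed.

(* [TSeg] starts at the beginning of the block of [i], possibly before [i]. *)
Lemma filter_rng_block J i : (i <= tw_last rho)%N ->
  [seq k <- rng rho 0 | tm rho k - tm rho i \in itv_of R J] =
  [seq k <- rng rho (block_first rho i)
     | tm rho k - tm rho (block_first rho i) \in itv_of R J].
Proof.
move=> lei; rewrite tm_block_first; have bi := block_first_le rho i.
have {1}-> : rng rho 0 = iota 0 (block_first rho i) ++ rng rho (block_first rho
  i).
  by rewrite /rng -{2}[block_first rho i]add0n -iotaD; congr iota; lia.
rewrite filter_cat (_ : [seq k <- iota _ _ | _] = [::]) //.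
apply/eqP; rewrite -[_ == _]negbK -has_filter; apply/hasPn => k.
rewrite mem_iota add0n => /(tm_lt_block_first lei) ltk.
by apply/negP => /itv_of_ge0; rewrite subr_ge0 leNgt ltk.
Qed.

End NatSat.

Lemma bdef_ratmtl (R : realType) (Sigma : finType) (phi : ratmtl Sigma) :
  bdef (nsat (R := R) phi).
Proof.
elim: phi => [a||p IHp q IHq|p IHp|J p IHp q IHq|J n F IHF re|J n F IHF re p
  IHp].
- by apply: bdef_def; exact: (def_letter _ (fun X : letter Sigma => a \in val
  X)).
- by apply: bdef_def; exact: def_const.
- exact: bdef_and.
- exact: bdef_not.
- have [|M dM] := @bdef_join R _ bool (fun b => nsat (if b then p else q)).
    by case.
  (* Until is treated as [FRat] over the single formula [p] with the language of all words. *)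
  exists M; have [Q g q0 Fin sF] := recog_all unit.
  apply: mdef_ext (mdef_frat J g q0 Fin (fun _ => dM true) (dM false)).
  move=> rho i lei; rewrite nsat_until //; split=> -[j [w [? ? ? ?]]].
    by exists j, w.
  by exists j, w; split=> //; apply/sF.
- have [M dM] := bdef_join IHF; have [Q g q0 Fin sF] := recog_regex re.
  apply: bdef_ext (bdef_block_first (existT _ M (mdef_rat J g q0 Fin dM))).
  move=> rho i lei; rewrite nsat_rat // filter_rng_block //.
  by split=> -[w [? ?]]; exists w; split=> //; apply/sF.
- have [|M dM] := @bdef_join R _ (option 'I_n)
      (fun o => nsat (if o is Some x then F x else p)); first by case.
  exists M; have [Q g q0 Fin sF] := recog_regex re.
  apply: mdef_ext (mdef_frat J g q0 Fin (fun x => dM (Some x)) (dM None)).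
  move=> rho i lei; rewrite nsat_frat //; split=> -[j [w [? ? ? ? ?]]];
  by exists j, w; split=> //; apply/sF.
Qed.

(** * From definable predicates to automata in normal form *)

Section ToAta.
Variables (R : realType) (Gamma : finType).

Lemma sa_loop_free (A : sa Gamma) (s0 : sloc A) : shd s0 = s0 ->
  loop_free_resets (Ata s0 (sfin A) (@sdl _ A)).
Proof.
move=> hs0; pose Sr : {set sloc A} := [set s | shd s == s].
have s0r : s0 \in Sr by rewrite inE hs0.
have hdr s : shd s \in Sr by rewrite inE shdK.
pose isl (s : sloc A) := enum_rank_in s0r (shd s).
have valisl s : enum_val (isl s) = shd s by exact: enum_rankK_in.
exists Sr, #|Sr|, isl, (fun i => enum_val i), (fun p q => (srk p < srk q)%N).
split; last 1 first.
- move=> i p a q; rewrite inE => /eqP<- /sdl_reset[hq rq].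
  by exists (isl q); rewrite !valisl hq.
- split=> //=.
  + move=> i; apply/setP=> s; rewrite !inE;
    apply/andP/eqP => [[/eqP<- /eqP hs]|->].
      by rewrite valisl hs.
    have := enum_valP i; rewrite inE => /eqP hi.
    by rewrite /isl hi enum_valK_in eqxx.
  + by move=> i s a q _ /sdl_reset[hq _]; rewrite inE hq.
  + move=> i s a q; rewrite !inE => /eqP<- /sdl_loc[hq nq].
    by rewrite /isl hq eqxx andbT -/(isl s) valisl; apply/eqP.
- by move=> p _; rewrite /= ltnn.
- by move=> q p r _ _ _; exact: ltn_trans.
Qed.

Variables (P : tword R Gamma -> nat -> Prop) (dP : def P).
Let A := fsa dP.
(** [None] is a new initial location, alone in its island and above all others in rank. Since the
    entry formula is pure, it is left for good at the first letter. *)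
Let S : finType := option (sloc A).
Let hd (s : S) : S := omap (@shd _ A) s.
Let rk (s : S) : nat :=
  if s is Some t then srk t else (\max_t @srk _ A t).+1.
Let dl (s : S) (a : Gamma) : trans S :=
  if s is Some t then tmap Some (sdl t a) else tmap Some (fent dP tt a).

Lemma top_hdK s : hd (hd s) = hd s.
Proof. by case: s => //= t; rewrite shdK. Qed.

Lemma top_reset s a q : occurs_reset q (dl s a) ->
  hd q = q /\ (rk q < rk (hd s))%N.
Proof.
case: s => [t|] /= /occurs_reset_map[p ->].
  by case/sdl_reset=> hp pr; rewrite /= hp.
move/(pure_reset (fpure dP _ _)) => /= hp.
by rewrite hp ltnS; split=> //; exact: leq_bigmax.
Qed.

Lemma top_loc s a q : occurs_loc q (dl s a) -> hd q = hd s /\ q <> hd s.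
Proof.
case: s => [t|] /= /occurs_loc_map[p ->].
  by case/sdl_loc=> hp pr; rewrite /= hp; split=> // -[].
by rewrite (negPf (pure_loc p (fpure dP _ _))).
Qed.

Definition top_sa :=
  Sa [set s : S | if s is Some t then t \in sfin A else true]
    top_hdK top_reset top_loc.

Lemma sacc_top rho k : (k <= (tw_last rho).+1)%N -> forall (t : sloc A) (r : R),
  sacc (A := top_sa) rho k (Some t) r <-> sacc (A := A) rho k t r.
Proof.
move: k; apply: backward_ind => [t r|k kn IH t r].
  by rewrite /sacc !acc_last inE.
rewrite /sacc !accS //= teval_map /=.
by apply: teval_ext => p _; apply: IH.
Qed.

Lemma ata_of_def : exists A0 : ata Gamma, loop_free_resets A0 /\
  forall rho, ata_lang R A0 rho <-> P rho 0%N.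
Proof.
exists (Ata (None : sloc top_sa) (sfin top_sa) (@sdl _ top_sa)); split.
  exact: sa_loop_free.
move=> rho; rewrite ata_langE accS //= (fspec dP tt) // /entry_sat teval_map.
rewrite (teval_pure _ 0 _ (fun=> False) _ (fpure dP _ _)).
by apply: teval_ext => // q _; apply: sacc_top.
Qed.

End ToAta.

Lemma ratmtl_to_ata (R : realType) (Sigma : finType) (phi : ratmtl Sigma) :
  exists A : ata (letter Sigma),
    loop_free_resets A /\ ata_lang R A = ratmtl_lang R phi.
Proof.
have [M [D dD sD]] := bdef_ratmtl R phi.
(* Position 0 starts a block, so the tests determine the memory there and plain definability is
   recovered. *)
have d0 : def (fun rho i => exists v, mtest v rho i /\ D v rho i).
  by apply: def_ex => v; apply: def_and => //; exact: mtest_def.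
have [A [lA sA]] := ata_of_def d0; exists A; split=> //.
apply/seteqP; split=> rho.
  move=> /sA[v [/mtestP h Dv]]; apply/ratmtl_langE/sD => //.
  by rewrite h.
move=> /ratmtl_langE sphi; apply/sA; exists (mstate M rho 0).
by split; [exact/mtestP | apply/sD].
Qed.

(** * Regular expressions for paths, Boolean connectives *)

Section PathRegex.
Variables (X : eqType) (Q : finType) (lt : Q -> Q -> X).

(* The words labelling the paths from [x] to [y] in the complete graph on [Q]
   whose intermediate vertices are in [s] (McNaughton-Yamada). *)
Fixpoint path_re (s : seq Q) (x y : Q) : regex X :=
  if s is z :: s' then
    RPlus (path_re s' x y)
      (RCat (path_re s' x z) (RCat (RStar (path_re s' z z)) (path_re s' z y)))
  else if x == y then RPlus REps (RLetter (lt x y)) else RLetter (lt x y).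

Lemma path_re_sound s x y w : re_lang (path_re s x y) w ->
  exists2 p, w = pairmap lt x p & last x p = y.
Proof.
elim: s x y w => [|z s IHs] x y w /=.
  case: eqP => [<-|_] /=; last by move=> ->; exists [:: y].
  by case=> ->; [exists [::] | exists [:: x]].
case=> [/IHs//|[_ [_ [-> /IHs[p1 -> e1] [_ [_ [-> [us -> hus] /IHs[p3 ->
  e3]]]]]]]].
have [p2 -> e2] : exists2 p2, flatten us = pairmap lt z p2 & last z p2 = z.
  elim: us hus => [|u us IHus] /= hus; first by exists [::].
  have /IHs[p -> ep] := hus u (mem_head _ _).
  have [|q -> eq] := IHus; first by move=> u' uus; apply: hus;
    rewrite inE uus orbT.
  by exists (p ++ q); rewrite ?pairmap_cat ?last_cat ep.
by exists (p1 ++ p2 ++ p3); rewrite ?pairmap_cat ?last_cat e1 ?e2.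
Qed.

Lemma path_re_nil s x : re_lang (path_re s x x) [::].
Proof. by elim: s => [|z s IHs] /=; [rewrite eqxx; left | left]. Qed.

Lemma path_re_complete s x y p : {subset p <= s} ->
  re_lang (path_re s x y) (pairmap lt x (rcons p y)).
Proof.
elim: s x y p => [|z s IHs] x y p ps.
  case: p ps => [_|u p /(_ u (mem_head _ _))] //=.
  by case: eqP => _; [right|].
have sub p' : {subset p' <= z :: s} -> z \notin p' -> {subset p' <= s}.
  by move=> h zp u up; have := h u up; rewrite inE => /predU1P[uz|//];
    rewrite -uz up in zp.
have split_z p' : z \in p' -> exists p1 p2, [/\ p' = rcons p1 z ++ p2 & z
  \notin p1].
  move=> zp; exists (take (index z p') p'), (drop (index z p').+1 p').
  split; first by rewrite cat_rcons -{2}(nth_index z zp) -drop_nth ?index_mem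
    // cat_take_drop.
  by apply/negP => /index_ltn; rewrite ltnn.
have [zp|zp] := boolP (z \in p); last by left; apply: IHs; apply: sub.
(* Cutting a path from [z] at its next visit to [z] splits off one factor of the star; [n] bounds
   the length for the induction. *)
have tail n : forall p', (size p' <= n)%N -> {subset p' <= z :: s} ->
    re_lang (RCat (RStar (path_re s z z)) (path_re s z y)) (pairmap lt z (rcons
      p' y)).
  elim: n => [|n IHn] p' sp hp'; (have [zp'|zp'] := boolP (z \in p');
    last first;
    first by (exists [::]; eexists; split=> //; [exists [::] | apply: IHs;
      apply: sub])).
    by case: p' sp zp' {hp'}.
  have [p1 [p2 [e z1]]] := split_z _ zp'.
  have [||u1 [v2 [ev [us eu hus] hv2]]] := IHn p2.
  - by move: sp; rewrite e size_cat size_rcons; lia.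
  - by move=> u up; apply: hp'; rewrite e mem_cat up orbT.
  rewrite e rcons_cat pairmap_cat last_rcons ev eu.
  exists (pairmap lt z (rcons p1 z) ++ flatten us), v2; split; rewrite ?catA //.
  exists (pairmap lt z (rcons p1 z) :: us) => // u; rewrite inE.
  case/predU1P=> [->|]; last exact: hus.
  apply: IHs; apply: sub => // u' up1; apply: hp'.
  by rewrite e mem_cat mem_rcons inE up1 orbT.
right; have [p1 [p2 [e z1]]] := split_z _ zp.
rewrite e rcons_cat pairmap_cat last_rcons.
exists (pairmap lt x (rcons p1 z)), (pairmap lt z (rcons p2 y)); split=> //.
  apply: IHs; apply: sub => // u' up1; apply: ps.
  by rewrite e mem_cat mem_rcons inE up1 orbT.
apply: (tail (size p2)) => // u up; apply: ps.
by rewrite e mem_cat up orbT.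
Qed.

(** The expression admits every chain of edges from [x] to [y]; the constraint sits in the letters,
    since the edge from [a] to [b] holds at [k] only if [a = st k b]. The one chain that matches is
    the backward computation from [y], read from left to right. *)
Lemma matches_path_re (T : X -> nat -> Prop) (st : nat -> Q -> Q) l x y :
  (forall k a b, k \in l -> T (lt a b) k <-> a = st k b) ->
  (exists w, matches T w l /\ re_lang (path_re (enum Q) x y) w) <->
  x = foldr st y l.
Proof.
move=> hT; split.
  case=> w [wm /path_re_sound[p wp]] => ep.
  elim: l x p w wm wp ep hT => [|k l IHl] x p w.
    by move=> /matches_nil->; case: p => //= _ ->.
  case/matches_cons=> t [w' [-> Tt wm]]; case: p => //= b p [tb wp] ep hT.
  move: Tt; rewrite tb => /hT-> ; last exact: mem_head.
  congr (st k _); apply: (IHl _ _ _ wm wp ep) => k' a' b' kl.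
  by apply: hT; rewrite inE kl orbT.
move=> xe.
have [p pm pl] : exists2 p, matches T (pairmap lt x p) l & last x p = y.
  elim: l x hT xe => [|k l IHl] x hT /= xe; first by exists [::].
  have [|p pm pl] := IHl _ _ erefl.
    by move=> k' a' b' kl; apply: hT; rewrite inE kl orbT.
  exists (foldr st y l :: p) => //; apply/matches_cons.
  by exists (lt x (foldr st y l)), (pairmap lt (foldr st y l) p); split=> //;
    apply/hT; rewrite ?mem_head.
exists (pairmap lt x p); split=> //.
case/lastP: p {pm} pl => [/= <-|p z]; first exact: path_re_nil.
by rewrite last_rcons => <-; apply: path_re_complete => u _; rewrite mem_enum.
Qed.

End PathRegex.

Section Connectives.
Variables (R : realType) (Sigma : finType).
Implicit Types (rho : tword R (letter Sigma)).

Definition mconst (b : bool) : ratmtl Sigma :=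
  if b then MTrue else MNot MTrue.
Definition mor (p q : ratmtl Sigma) := MNot (MAnd (MNot p) (MNot q)).
Definition mbigand (I : finType) (f : I -> ratmtl Sigma) : ratmtl Sigma :=
  foldr (fun i g => MAnd (f i) g) MTrue (enum I).
Definition mbigor (I : finType) (f : I -> ratmtl Sigma) : ratmtl Sigma :=
  MNot (mbigand (fun i => MNot (f i))).
Definition mletter_eq (a : letter Sigma) : ratmtl Sigma :=
  mbigand (fun x => if x \in val a then MLetter x else MNot (MLetter x)).
Definition msame_next : ratmtl Sigma := MUntil zero_itv (mconst false) MTrue.

Lemma nsat_const b rho k : nsat (mconst b) rho k <-> b.
Proof. by case: b; rewrite /nsat /=; split=> // /(_ I). Qed.

Lemma nsat_and p q rho k : nsat (MAnd p q) rho k <-> nsat p rho k /\ nsat q rho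
  k.
Proof. by []. Qed.

Lemma nsat_not p rho k : nsat (MNot p) rho k <-> ~ nsat p rho k.
Proof. by []. Qed.

Lemma nsat_or p q rho k : nsat (mor p q) rho k <-> nsat p rho k \/ nsat q rho k.
Proof. by rewrite /mor nsat_not nsat_and !nsat_not -not_orP notK. Qed.

Lemma nsat_bigand (I : finType) (f : I -> ratmtl Sigma) rho k :
  nsat (mbigand f) rho k <-> forall i, nsat (f i) rho k.
Proof.
transitivity (forall i, i \in enum I -> nsat (f i) rho k); last first.
  by split=> h i *; apply: h; rewrite ?mem_enum.
rewrite /mbigand; elim: (enum I) => //= i s IHs; rewrite nsat_and IHs.
split=> [[fi fs] j|h]; first by rewrite inE => /predU1P[->|/fs].
by split=> [|j js]; apply: h; rewrite inE ?eqxx // js orbT.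
Qed.

Lemma nsat_bigor (I : finType) (f : I -> ratmtl Sigma) rho k :
  nsat (mbigor f) rho k <-> exists i, nsat (f i) rho k.
Proof.
rewrite /mbigor nsat_not nsat_bigand; split=> [/existsNP[i fi]|[i fi]].
  by exists i; apply: contrapT.
by move/(_ i); apply.
Qed.

Lemma nsat_letter_eq a rho k : nsat (mletter_eq a) rho k <-> sg rho k = a.
Proof.
rewrite nsat_bigand; split=> [h|<- x].
  apply: val_inj; apply/setP=> x; have := h x; case: ifP => xa.
    by move=> xs; apply/idP.
  by move=> xs; apply/negP.
by case: ifP => // /negP.
Qed.

Lemma nsat_same_next rho k : (k <= tw_last rho)%N ->
  nsat msame_next rho k <-> same_next rho k.
Proof.
move=> lek; rewrite nsat_until //; split.
  case=> j [w [/andP[+ jn] _ + wm]].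
  rewrite mem_zero_itv subr_eq0 leq_eqVlt => /predU1P[kj|kj] /eqP tj.
    by split; rewrite kj.
  move: wm; rewrite -(subnSK kj) => /matches_cons[_ [_ [_ /nsat_const]]] //.
move=> [lk tk]; exists k.+1, [::]; rewrite subnn mem_zero_itv tk subrr ltnSn lk.
by split.
Qed.

End Connectives.

(** * From automata to formulas *)

Section Regions.
Variable R : realType.

Definition itv_const_le (c : nat) (J : nat_interval) : bool :=
  ((left_bound J).1 <= c)%N && (if right_bound J is Some (u, _) then u <= c
    else true)%N.

Fixpoint clocks_le (S : Type) (c : nat) (f : trans S) : bool :=
  match f with
  | TAnd f1 f2 | TOr f1 f2 => clocks_le c f1 && clocks_le c f2
  | TClock J => itv_const_le c J
  | _ => true
  end.

Lemma itv_const_leW c c' J : (c <= c')%N -> itv_const_le c J -> itv_const_le c'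
  J.
Proof.
move=> cc /andP[h1 h2]; apply/andP; split; first exact: leq_trans cc.
by case: (right_bound J) h2 => // -[u _] h2; exact: leq_trans cc.
Qed.

Lemma clocks_leW (S : Type) c c' (f : trans S) :
  (c <= c')%N -> clocks_le c f -> clocks_le c' f.
Proof.
move=> cc; elim: f => [||f IHf g IHg|f IHf g IHg|s|J|s] //=;
  try by case/andP=> /IHf-> /IHg->.
exact: itv_const_leW.
Qed.

Lemma clocks_le_ex (S : Type) (f : trans S) : exists c, clocks_le c f.
Proof.
elim: f => [||f [c hf] g [c' hg]|f [c hf] g [c' hg]|s|J|s] /=;
  try by exists 0%N.
- by exists (maxn c c'); rewrite (clocks_leW _ hf) ?(clocks_leW _ hg) ?leq_maxl
  ?leq_maxr.
- by exists (maxn c c'); rewrite (clocks_leW _ hf) ?(clocks_leW _ hg) ?leq_maxl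
  ?leq_maxr.
- exists (maxn (left_bound J).1 (if right_bound J is Some (u, _) then u else
  0)%N).
  by rewrite /itv_const_le leq_maxl; case: (right_bound J) => // -[u _];
    rewrite leq_maxr.
Qed.

(** On the nonnegative reals the classes are the one-clock regions: the points 0, ..., [c], the open
    unit intervals between them, and the ray above [c]. *)
Definition region_eq (c : nat) (x y : R) : Prop := forall m, (m <= c)%N ->
  (m%:R <= x) = (m%:R <= y) /\ (x <= m%:R) = (y <= m%:R).

Lemma region_eq_itv c J x y :
  itv_const_le c J -> region_eq c x y -> (x \in itv_of R J) = (y \in itv_of R
    J).
Proof.
case: J => [[l cl] r] /andP[/= lc rc] xy; rewrite !in_itv /=.
have [l1 l2] := xy _ lc; congr (_ && _).
  by case: cl => /=; rewrite ?l1 // !ltNge l2.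
case: r rc => [[u cu] /= uc|//]; have [u1 u2] := xy _ uc.
by case: cu => /=; rewrite ?u2 // !ltNge u1.
Qed.

Lemma region_eq_open c p (x y : R) :
  p%:R < x < p.+1%:R -> p%:R < y < p.+1%:R -> region_eq c x y.
Proof.
move=> /andP[px xp] /andP[py yp] m _.
have [mp|pm] := leqP m p.
  have mR : (m%:R <= p%:R :> R) by rewrite ler_nat.
  have mx : m%:R < x by exact: le_lt_trans px.
  have my : m%:R < y by exact: le_lt_trans py.
  by rewrite (ltW mx) (ltW my) !leNgt mx my.
have mR : (p.+1%:R <= m%:R :> R) by rewrite ler_nat.
have mx : x < m%:R by exact: lt_le_trans mR.
have my : y < m%:R by exact: lt_le_trans mR.
by rewrite (ltW mx) (ltW my) !leNgt mx my.
Qed.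

Lemma region_eq_unbounded c (x y : R) : c%:R < x -> c%:R < y -> region_eq c x y.
Proof.
move=> px py m mc.
have mR : (m%:R <= c%:R :> R) by rewrite ler_nat.
have mx : m%:R < x by exact: le_lt_trans px.
have my : m%:R < y by exact: le_lt_trans py.
by rewrite (ltW mx) (ltW my) !leNgt mx my.
Qed.

End Regions.

Section RangeSplit.
Variables (R : realType) (Gamma : finType) (rho : tword R Gamma).

(** A lower bound on the clock selects a final segment of the word, because time stamps increase;
    this cuts the backward computation at region boundaries. *)
Lemma filter_rng_split (a b : pred nat) k : (k <= (tw_last rho).+1)%N ->
  (forall j j', (k <= j <= j')%N -> (j' <= tw_last rho)%N -> b j -> b j') ->
  (forall j, b j -> a j) ->
  [seq j <- rng rho k | a j] =
  [seq j <- rng rho k | a j && ~~ b j] ++ [seq j <- rng rho k | b j].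
Proof.
move=> kn + ba; move: k kn; apply: backward_ind => [_|k kn IH mono].
  by rewrite rng_last.
have [bk|nbk] := boolP (b k).
  have all_b j : j \in rng rho k -> b j.
    by rewrite mem_rng => /andP[kj jn]; apply: (mono k) => //; rewrite leqnn.
  rewrite [X in X ++ _](_ : _ = [::]); last first.
    rewrite -(filter_pred0 (rng rho k)); apply: eq_in_filter => j /all_b ->.
    by rewrite andbF.
  by apply: eq_in_filter => j /all_b bj; rewrite bj ba.
rewrite rngS //= (negPf nbk) andbT IH; first by case: (a k).
by move=> j j' jj; apply: mono; lia.
Qed.

Lemma same_block_iota i j : (i <= j <= tw_last rho)%N -> tm rho j = tm rho i ->
  ~ same_next rho j ->
  [seq k <- rng rho i.+1 | tm rho k - tm rho i == 0] = iota i.+1 (j - i).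
Proof.
move=> /andP[ij jn] tj nj.
have -> : rng rho i.+1 = iota i.+1 (j - i) ++ rng rho j.+1.
  rewrite /rng.
  have -> : ((tw_last rho).+1 - i.+1 = (j - i) + ((tw_last rho).+1 - j.+1))%N
    by lia.
  by rewrite iotaD; congr (_ ++ iota _ _); lia.
rewrite filter_cat [X in _ ++ X](_ : _ = [::]) ?cats0.
  apply/all_filterP/allP => k; rewrite mem_iota => kij.
  rewrite subr_eq0 eq_le -{1}tj !tm_mono //; lia.
apply/eqP; rewrite -[_ == _]negbK -has_filter; apply/hasPn => k.
rewrite mem_rng subr_eq0 => /andP[jk kn]; apply/eqP => tk; apply: nj; split;
  first lia.
apply/eqP; rewrite eq_le [X in _ && X]tm_mono ?andbT ?tj -?tk; last by lia.
by apply: tm_mono; lia.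
Qed.

Lemma same_block_last i : (i <= tw_last rho)%N -> exists j,
  [/\ (i <= j <= tw_last rho)%N, tm rho j = tm rho i & ~ same_next rho j].
Proof.
move=> lei; pose P j := (i <= j <= tw_last rho)%N && (tm rho j == tm rho i).
have exP : exists j, P j by exists i; rewrite /P leqnn lei eqxx.
have ubP j : P j -> (j <= tw_last rho)%N by case/andP=> /andP[].
have [j /andP[ij /eqP tj] maxj] := ex_maxnP exP ubP.
exists j; split=> // -[jn tj1]; have := maxj j.+1; rewrite /P tj1 tj eqxx andbT.
by rewrite ltnn jn => h; move: (h ltac:(lia)).
Qed.

End RangeSplit.

Section TransFormula.
Variables (R : realType) (Sigma : finType) (S : finType).

(** [nu] represents the region of the clock, so clock atoms turn into constants. *)
Fixpoint tform (nu : R) (fl fr : S -> ratmtl Sigma) (f : trans S) : ratmtl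
  Sigma :=
  match f with
  | TTop => MTrue
  | TBot => mconst Sigma false
  | TAnd f1 f2 => MAnd (tform nu fl fr f1) (tform nu fl fr f2)
  | TOr f1 f2 => mor (tform nu fl fr f1) (tform nu fl fr f2)
  | TLoc p => fl p
  | TClock J => mconst Sigma (nu \in itv_of R J)
  | TReset q => fr q
  end.

Lemma nsat_tform c (nu nu' : R) fl fr (L X : S -> Prop) f
    (rho : tword R (letter Sigma)) k :
  clocks_le c f -> region_eq c nu nu' ->
  (forall p, occurs_loc p f -> nsat (fl p) rho k <-> L p) ->
  (forall q, occurs_reset q f -> nsat (fr q) rho k <-> X q) ->
  nsat (tform nu fl fr f) rho k <-> teval nu' L X f.
Proof.
move=> + reg; elim: f => [||f IHf g IHg|f IHf g IHg|s|J|s] //=.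
- by move=> *; split=> // /(_ I).
- move=> /andP[cf cg] hL hX; rewrite nsat_and IHf ?IHg //;
    by move=> p po; (apply: hL || apply: hX); rewrite po ?orbT.
- move=> /andP[cf cg] hL hX; rewrite nsat_or IHf ?IHg //;
    by move=> p po; (apply: hL || apply: hX); rewrite po ?orbT.
- by move=> _ hL _; apply: hL.
- by move=> cJ _ _; rewrite nsat_const (region_eq_itv cJ reg).
- by move=> _ _ hX; apply: hX.
Qed.

End TransFormula.

(** * The backward computation of one island, expressed by formulas *)

Section IslandFormula.
Variables (R : realType) (Sigma : finType) (A : ata (letter Sigma)).
Variables (P : pred (loc A)) (fr : loc A -> ratmtl Sigma) (c : nat).
Local Notation acc rho := (@acc R _ _ (@delta _ A) (final A) rho).
Hypothesis locP : forall s a p, P s -> occurs_loc p (delta s a) -> P p.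
Hypothesis frP : forall s a q, P s -> occurs_reset q (delta s a) ->
  forall rho k, (k <= tw_last rho)%N ->
  nsat (fr q) rho k <-> acc rho k.+1 q (tm rho k).
Hypothesis clocksP : forall s a, clocks_le c (@delta _ A s a).

Let Q : finType := {set loc A}.
Let Fin : Q := [set s in final A | P s].

Section Step.
Variables (rho : tword R (letter Sigma)) (r : R).

(* Acceptance inside the island is computed backwards by this function on sets
   of locations. *)
Definition back_step (k : nat) (Y : Q) : Q :=
  [set s | P s && `[< teval (tm rho k - r) (fun p => p \in Y)
     (fun q => acc rho k.+1 q (tm rho k)) (delta s (sg rho k)) >]].

Lemma foldr_back_step k : (k <= (tw_last rho).+1)%N ->
  foldr back_step Fin (rng rho k) = [set s | P s && `[< acc rho k s r >]].
Proof.
move: k; apply: backward_ind => [|k kn IH].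
  rewrite rng_last; apply/setP => s; rewrite !inE andbC acc_last;
    congr (_ && _).
  by apply/idP/asboolP.
rewrite rngS //= IH; apply/setP=> s; rewrite !inE accS //.
have [Ps|//] := boolP (P s); congr (_ && _).
apply/asbool_equiv_eq/teval_ext => // p po; rewrite inE (locP Ps po).
by split=> /asboolP.
Qed.

End Step.

Definition step_form (nu : R) (XY : Q * Q) : ratmtl Sigma :=
  mbigand (fun s => if P s then mbigor (fun a : letter Sigma =>
      MAnd (mletter_eq a)
        (let f := tform nu (fun p => mconst Sigma (p \in XY.2)) fr (delta s a)
          in
         if s \in XY.1 then f else MNot f))
    else mconst Sigma (s \notin XY.1)).

Lemma nsat_step_form nu rho r k X Y : (k <= tw_last rho)%N ->
  region_eq c nu (tm rho k - r) ->
  nsat (step_form nu (X, Y)) rho k <-> X = back_step rho r k Y.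
Proof.
move=> kn reg; rewrite nsat_bigand.
have stepE s : nsat (if P s then mbigor (fun a : letter Sigma =>
      MAnd (mletter_eq a)
        (let f := tform nu (fun p => mconst Sigma (p \in Y)) fr (delta s a) in
         if s \in X then f else MNot f))
    else mconst Sigma (s \notin X)) rho k <-> (s \in X) = (s \in back_step rho
      r k Y).
  rewrite inE; case: ifPn => [Ps|_]; last first.
    by rewrite nsat_const /=; case: (s \in X).
  have tE := @nsat_tform R Sigma _ c nu (tm rho k - r)
    (fun p => mconst Sigma (p \in Y)) fr (fun p => p \in Y)
    (fun q => acc rho k.+1 q (tm rho k)) (delta s (sg rho k)) rho k
    (clocksP _ _) reg (fun p _ => nsat_const _ _ _)
    (fun q qo => frP Ps qo kn).
  rewrite nsat_bigor /=; split.
    case=> a; rewrite nsat_and nsat_letter_eq => -[<-].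
    by case: (s \in X); [move/tE/asboolT | move=> h; rewrite asboolF // => /tE].
  move=> e; exists (sg rho k); rewrite nsat_and nsat_letter_eq; split=> //.
  by case: (s \in X) e => /esym; [move/asboolP/tE | move/negbT/asboolPn => h
    /tE].
split=> [h|eX s]; last by apply: (proj2 (stepE s)); rewrite eX.
by apply/setP=> s; exact: (proj1 (stepE s) (h s)).
Qed.

Let N := #|{: Q * Q}|.
Definition step_family (nu : R) (l : 'I_N) : ratmtl Sigma :=
  step_form nu (enum_val l).
Let edge (X Y : Q) : 'I_N := enum_rank (X, Y).
Definition edge_re (X Y : Q) : regex 'I_N := path_re edge (enum Q) X Y.

Lemma matches_edge_re nu rho r l X Y :
  (forall k, k \in l -> (k <= tw_last rho)%N /\ region_eq c nu (tm rho k - r))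
    ->
  (exists w, matches (fun x => nsat (step_family nu x) rho) w l /\
             re_lang (edge_re X Y) w) <->
  X = foldr (back_step rho r) Y l.
Proof.
move=> hl; apply: matches_path_re => k a b kl; have [kn reg] := hl k kl.
by rewrite /step_family enum_rankK; exact: nsat_step_form.
Qed.

Definition rat_form (J : nat_interval) (nu : R) (X Y : Q) : ratmtl Sigma :=
  MRat J (step_family nu) (edge_re X Y).

Lemma nsat_rat_form J nu rho i X Y : (i <= tw_last rho)%N ->
  (forall x, x \in itv_of R J -> 0 < x /\ region_eq c nu x) ->
  nsat (rat_form J nu X Y) rho i <->
  X = foldr (back_step rho (tm rho i)) Y
    [seq k <- rng rho i.+1 | tm rho k - tm rho i \in itv_of R J].
Proof.
move=> lei hJ; rewrite nsat_rat //.
have -> : [seq k <- rng rho 0 | tm rho k - tm rho i \in itv_of R J] =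
    [seq k <- rng rho i.+1 | tm rho k - tm rho i \in itv_of R J].
  have -> : rng rho 0 = iota 0 i.+1 ++ rng rho i.+1.
    by rewrite /rng -{2}[i.+1]add0n -iotaD; congr iota; lia.
  rewrite filter_cat (_ : [seq k <- iota _ _ | _] = [::]) //.
  apply/eqP; rewrite -[_ == _]negbK -has_filter; apply/hasPn => k.
  rewrite mem_iota => ki; apply/negP => /hJ[+ _]; rewrite subr_gt0 ltNge.
  by rewrite tm_mono //; lia.
apply: matches_edge_re => k; rewrite mem_filter mem_rng => /andP[/hJ[_ reg]].
by case/andP.
Qed.

(** For [d + p = c] the recursion visits the regions above [p] in order, guessing the sets at their
    boundaries. The representatives are the midpoint of an open interval, the point itself, and
    [c + 1] for the ray. No interval contains 0, so each [Rat] sees only positions after [i]. *)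
Fixpoint tail_form (d p : nat) (X : Q) : ratmtl Sigma :=
  if d is d'.+1 then
    mbigor (fun Y => MAnd
      (rat_form (NatInterval (p, false) (Some (p.+1, false))) (p%:R + 2^-1) X Y)
      (mbigor (fun Z => MAnd
        (rat_form (NatInterval (p.+1, true) (Some (p.+1, true))) p.+1%:R Y Z)
        (tail_form d' p.+1 Z))))
  else rat_form (NatInterval (p, false) None) p.+1%:R X Fin.

Lemma nsat_tail_form d p rho i X : (i <= tw_last rho)%N -> (d + p = c)%N ->
  nsat (tail_form d p X) rho i <->
  X = foldr (back_step rho (tm rho i)) Fin
    [seq k <- rng rho i.+1 | p%:R < tm rho k - tm rho i].
Proof.
move=> lei; elim: d p X => [|d IHd] p X /= dp.
  rewrite add0n in dp; rewrite nsat_rat_form //; last first.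
    move=> x; rewrite in_itv /= andbT => px; split.
      exact: le_lt_trans px.
    by apply: region_eq_unbounded; rewrite -dp // ltr_nat.
  by under eq_filter do rewrite in_itv /= andbT.
have mono x j j' : (i.+1 <= j <= j')%N -> (j' <= tw_last rho)%N ->
    x <= tm rho j - tm rho i -> x <= tm rho j' - tm rho i.
  move=> jj jn h; apply: (le_trans h); rewrite lerD2r; apply: tm_mono; lia.
have mono' x j j' : (i.+1 <= j <= j')%N -> (j' <= tw_last rho)%N ->
    x < tm rho j - tm rho i -> x < tm rho j' - tm rho i.
  move=> jj jn h; apply: (lt_le_trans h); rewrite lerD2r; apply: tm_mono; lia.
rewrite (@filter_rng_split _ _ rho (fun k => p%:R < tm rho k - tm rho i)
  (fun k => p.+1%:R <= tm rho k - tm rho i)) //; last first.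
- by move=> j; apply: lt_le_trans; rewrite ltr_nat.
- by move=> j j'; exact: mono.
rewrite [X in _ ++ X](@filter_rng_split _ _ rho
  (fun k => p.+1%:R <= tm rho k - tm rho i)
  (fun k => p.+1%:R < tm rho k - tm rho i)) //; last first.
- by move=> j; exact: ltW.
- by move=> j j'; exact: mono'.
rewrite !foldr_cat nsat_bigor.
have openE Y Z : nsat (rat_form (NatInterval (p, false) (Some (p.+1, false)))
    (p%:R + 2^-1) Y Z) rho i <-> Y = foldr (back_step rho (tm rho i)) Z
    [seq k <- rng rho i.+1 | p%:R < tm rho k - tm rho i
                             & ~~ (p.+1%:R <= tm rho k - tm rho i)].
  rewrite nsat_rat_form //; last first.
    move=> x; rewrite in_itv /= => xp; split.
      by case/andP: xp => px _; exact: le_lt_trans px.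
    by apply: region_eq_open xp; rewrite -[p.+1%:R]natr1; apply/andP; split;
      lra.
  by under eq_filter do rewrite in_itv /= [_ < p.+1%:R]ltNge.
have pointE Y Z : nsat (rat_form (NatInterval (p.+1, true) (Some (p.+1, true)))
    p.+1%:R Y Z) rho i <-> Y = foldr (back_step rho (tm rho i)) Z
    [seq k <- rng rho i.+1 | p.+1%:R <= tm rho k - tm rho i
                             & ~~ (p.+1%:R < tm rho k - tm rho i)].
  rewrite nsat_rat_form //; last first.
    move=> x; rewrite in_itv /= => /andP[h1 h2].
    have -> : x = p.+1%:R by apply/eqP; rewrite eq_le h1 h2.
    by split=> //; rewrite ltr0n.
  by under eq_filter do rewrite in_itv /= [_ <= p.+1%:R]leNgt.
split.
  case=> Y; rewrite nsat_and openE nsat_bigor => -[-> [Z]].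
  by rewrite nsat_and pointE IHd => [[-> ->]//|]; lia.
move=> ->; eexists; rewrite nsat_and openE nsat_bigor; split; first by [].
by eexists; rewrite nsat_and pointE IHd; [split; reflexivity | lia].
Qed.

(** [Rat] over the point 0 would also see [i] and earlier positions of its block. [FRat] instead
    walks to the last position of the block, where [msame_next] fails; [Seg] stops just before it,
    so its step from [Y] to [W] is checked there by [step_form]. The first disjunct is the case
    where [i] is itself last. *)
Definition block_form (X Y : Q) : ratmtl Sigma :=
  mor (MAnd (mconst Sigma (X == Y)) (MNot (msame_next Sigma)))
    (mbigor (fun W => MFRat zero_itv (step_family 0) (edge_re X W)
       (MAnd (step_form 0 (W, Y)) (MNot (msame_next Sigma))))).

Lemma nsat_block_form rho i X Y : (i <= tw_last rho)%N ->
  nsat (block_form X Y) rho i <->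
  X = foldr (back_step rho (tm rho i)) Y
    [seq k <- rng rho i.+1 | tm rho k - tm rho i == 0].
Proof.
move=> lei; rewrite nsat_or nsat_and nsat_const nsat_not nsat_same_next //
  nsat_bigor.
have block_rcons j : (i < j)%N -> iota i.+1 (j - i) = iota i.+1 (j - i.+1) ++
  [:: j].
  move=> ij; rewrite -(subnSK ij) -[(_ - _).+1%N]addn1 iotaD /=;
    congr (_ ++ [:: _]); lia.
have reg0 j k : (i < j <= tw_last rho)%N -> tm rho j = tm rho i ->
    (i < k <= j)%N -> (k <= tw_last rho)%N /\ region_eq c 0 (tm rho k - tm rho
      i).
  move=> ij tj kij; split; first lia.
  suff -> : tm rho k = tm rho i by rewrite subrr.
  by apply/eqP; rewrite eq_le -{1}tj !tm_mono //; lia.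
split.
  case=> [[/eqP-> nn]|[W]].
    by rewrite (@same_block_iota _ _ _ i i) ?leqnn ?lei // subnn.
  rewrite nsat_frat // => -[j [w [ij]]].
  rewrite nsat_and nsat_not mem_zero_itv subr_eq0 => -[sW nj] /eqP tj wm wr.
  have [ltij jn] := andP ij.
  rewrite nsat_same_next // in nj; rewrite (@same_block_iota _ _ _ i j) ?(ltnW
    ltij) //.
  rewrite block_rcons // foldr_cat /=.
  have [_ regj] := reg0 j j ij tj ltac:(lia).
  move/(nsat_step_form _ _ jn regj): sW => <-.
  apply/matches_edge_re; last by exists w; split; [exact: wm |].
  by move=> k; rewrite mem_iota => kij; apply: (reg0 j) => //; lia.
have [j [ij tj nj]] := same_block_last lei; rewrite (same_block_iota ij tj nj).
move: ij; rewrite leq_eqVlt => /andP[/predU1P[ij|ij] jn].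
  by rewrite -ij subnn /= => ->; left; split=> //; rewrite ij.
have ij' : (i < j <= tw_last rho)%N by rewrite ij.
rewrite block_rcons // foldr_cat /= => eX; right.
exists (back_step rho (tm rho i) j Y).
have [_ regj] := reg0 j j ij' tj ltac:(lia).
have [|w [wm wr]] := proj2 (@matches_edge_re 0 rho (tm rho i) _ _ _ _) eX.
  by move=> k; rewrite mem_iota => kij; apply: (reg0 j) => //; lia.
rewrite nsat_frat //; exists j, w; rewrite mem_zero_itv tj subrr; split=> //.
by rewrite nsat_and nsat_not nsat_same_next //; split=> //;
  apply/(nsat_step_form _ _ jn regj).
Qed.

Definition loc_form (s : loc A) : ratmtl Sigma :=
  mbigor (fun X : Q => MAnd (mconst Sigma (s \in X))
    (mbigor (fun Y => MAnd (block_form X Y) (tail_form c 0 Y)))).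

Lemma nsat_loc_form s rho i : P s -> (i <= tw_last rho)%N ->
  nsat (loc_form s) rho i <-> acc rho i.+1 s (tm rho i).
Proof.
move=> Ps lei.
have rngE : rng rho i.+1 = [seq k <- rng rho i.+1 | tm rho k - tm rho i == 0] ++
    [seq k <- rng rho i.+1 | 0%:R < tm rho k - tm rho i].
  rewrite -{1}[rng rho i.+1]filter_predT (@filter_rng_split _ _ rho predT
    (fun k => 0%:R < tm rho k - tm rho i)) //.
    congr (_ ++ _); apply: eq_in_filter => k; rewrite mem_rng => ki /=.
    rewrite -leNgt eq_le andbC subr_ge0 tm_mono //; lia.
  by move=> j j' jj jn h; apply: (lt_le_trans h); rewrite lerD2r;
    apply: tm_mono; lia.
have := @foldr_back_step rho (tm rho i) i.+1 lei; rewrite rngE foldr_cat => fE.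
rewrite nsat_bigor; split.
  case=> X; rewrite nsat_and nsat_const nsat_bigor => -[sX [Y]].
  rewrite nsat_and nsat_block_form // nsat_tail_form ?addn0 // => -[XY YF].
  by move: sX; rewrite XY YF fE inE Ps => /asboolP.
set Y0 := foldr _ Fin _ in fE; set X0 := foldr _ Y0 _ in fE.
move=> h; exists X0; rewrite nsat_and nsat_const nsat_bigor; split.
  by rewrite fE inE Ps; apply/asboolP.
exists Y0; rewrite nsat_and; split; first exact/nsat_block_form.
by apply/nsat_tail_form; rewrite ?addn0.
Qed.

End IslandFormula.

Lemma ata_to_ratmtl (R : realType) (Sigma : finType) (A : ata (letter Sigma)) :
  loop_free_resets A -> exists phi : ratmtl Sigma, ratmtl_lang R phi = ata_lang
    R A.
Proof.
case=> Sr [k [isl [hdr [prec [[iniS islS resS locS] irr tr lfr]]]]].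
have hdrS i : hdr i \in Sr.
  by have := set11 (hdr i); rewrite -islS inE => /andP[].
have islh i : isl (hdr i) = i.
  by have := set11 (hdr i); rewrite -islS !inE => /andP[/eqP].
have [c clocks] : exists c, forall s a, clocks_le c (@delta _ A s a).
  have /choice[f hf] : forall sa : loc A * letter Sigma, exists c,
      clocks_le c (delta sa.1 sa.2) by move=> sa; exact: clocks_le_ex.
  exists (\max_sa f sa) => s a; apply: clocks_leW (hf (s, a)).
  exact: leq_bigmax.
have /choice[fs fsP] : forall s, exists f : ratmtl Sigma,
    forall rho i, (i <= tw_last rho)%N -> nsat f rho i <->
    @acc R _ _ (@delta _ A) (final A) rho i.+1 s (tm rho i).
  move=> s.
  (* The induction measure is the number of headers below that of the island: transitivity makes it
     weakly smaller for a reset target, and irreflexivity strictly so. *)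
  have [n] := ubnP #|[set p in Sr | prec p (hdr (isl s))]|.
  elim: n s => // n IHn s; rewrite ltnS => sn.
  have /choice[fr hfr] : forall q, exists f, prec q (hdr (isl s)) -> q \in Sr ->
      hdr (isl q) = q -> forall rho i, (i <= tw_last rho)%N ->
    nsat f rho i <-> @acc R _ _ (@delta _ A) (final A) rho i.+1 q (tm rho i).
    (* [choice] asks for a formula for every [q]; [MTrue] is the default wherever a premise
       fails. *)
    move=> q; have [pq|npq] := boolP (prec q (hdr (isl s)));
      last by exists MTrue => /negP.
    have [qS|nqS] := boolP (q \in Sr); last by exists MTrue => _ /negP.
    have [hq|nhq] := eqVneq (hdr (isl q)) q; last by exists MTrue => _ _ /eqP;
      rewrite (negPf nhq).
    have [|f hf] := IHn q; last by exists f.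
    apply: leq_trans sn; apply: proper_card; apply/properP; split.
      apply/fintype.subsetP=> p; rewrite !inE hq => /andP[pS ppq];
        rewrite pS /=.
      exact: (tr q p).
    by exists q; rewrite !inE ?qS ?pq // hq irr.
  exists (loc_form R (fun t => isl t == isl s) fr c s) => rho i lei.
  apply: nsat_loc_form => //.
    by move=> t a p ti po; have := locS (isl s) t a p;
      rewrite !inE ti => /(_ isT po)/andP[].
  move=> t a q ti qo rho' k' kn.
  have [|j qj pj] := lfr (isl s) t a q _ qo; first by rewrite inE.
  by apply: hfr => //; rewrite qj ?islh.
(* At position 0 both the time and the clock are 0, so a thread that keeps its clock behaves like
   one just reset and [fs] serves both kinds of atoms. For this reason [fs] was built for all
   locations and not for headers alone. *)
exists (mbigor (fun a => MAnd (mletter_eq a) (tform (0 : R) fs fs (delta (init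
  A) a)))).
have accE rho : ata_lang R A rho <->
    nsat (tform (0 : R) fs fs (delta (init A) (sg rho 0))) rho 0.
  rewrite ata_langE accS // tm0 subr0; apply: iff_sym.
  by apply: (@nsat_tform _ _ _ c) => // p _; rewrite fsP // tm0.
apply/seteqP; split=> rho.
  rewrite ratmtl_langE nsat_bigor => -[a].
  by rewrite nsat_and nsat_letter_eq => -[<- /accE].
move/accE => h; rewrite ratmtl_langE nsat_bigor; exists (sg rho 0).
by rewrite nsat_and nsat_letter_eq.
Qed.

Theorem theorem2 (R : realType) (Sigma : finType) :
  (forall A : ata (letter Sigma), loop_free_resets A ->
     exists phi : ratmtl Sigma, ratmtl_lang R phi = ata_lang R A) /\
  (forall phi : ratmtl Sigma,
     exists A : ata (letter Sigma),
       loop_free_resets A /\ ata_lang R A = ratmtl_lang R phi).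
Proof. by split; [exact: ata_to_ratmtl | exact: ratmtl_to_ata]. Qed.
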